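(* Let $f\in L^2(\Omega)$ and let $u\in H^2_0(\Omega)$ satisfy $a(u,v)=\int_\Omega fv\,dx$ for all $v\in H^2_0(\Omega)$. Let $\mathcal D=(X_{\mathcal D,0},\Pi_{\mathcal D},\nabla_{\mathcal D},\mathcal H^B_{\mathcal D})$ be a $B$-Hessian discretisation and let $u_{\mathcal D}\in X_{\mathcal D,0}$ be the solution of the Hessian scheme: $a_{\mathcal D}(u_{\mathcal D},v_{\mathcal D})=\int_\Omega f\,\Pi_{\mathcal D}v_{\mathcal D}\,dx$ for all $v_{\mathcal D}\in X_{\mathcal D,0}$. Assume $u\neq\Pi_{\mathcal D}u_{\mathcal D}$ and define $$g=\frac{u-\Pi_{\mathcal D}u_{\mathcal D}}{\|u-\Pi_{\mathcal D}u_{\mathcal D}\|}\in L^2(\Omega).$$ Let $\varphi_g\in H^2_0(\Omega)$ be the solution of the dual problem $a(w,\varphi_g)=\int_\Omega gw\,dx$ for all $w\in H^2_0(\Omega)$. Let $\mathcal P_{\mathcal D}:H^2_0(\Omega)\to X_{\mathcal D,0}$ be a mapping. Then $$\begin{aligned}\|\Pi_{\mathcal D}u_{\mathcal D}-u\|\lesssim{}&\big(\|\mathcal H^B_{\mathcal D}\mathcal P_{\mathcal D}u-\mathcal H^Bu\|+\mathrm{WS}^B_{\mathcal D}(u)\big)\big(\|\mathcal H^B_{\mathcal D}\mathcal P_{\mathcal D}\varphi_g-\mathcal H^B\varphi_g\|+\mathrm{WS}^B_{\mathcal D}(\varphi_g)\big)\\&+\|\Pi_{\mathcal D}\mathcal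 P_{\mathcal D}u-u\|+\|f\|\,\|\Pi_{\mathcal D}\mathcal P_{\mathcal D}\varphi_g-\varphi_g\|+\big|\mathcal W^B_{\mathcal D}(\mathcal Hu,\mathcal P_{\mathcal D}\varphi_g)\big|+\big|\mathcal W^B_{\mathcal D}(\mathcal H\varphi_g,\mathcal P_{\mathcal D}u)\big|,\end{aligned}$$ where $X\lesssim Y$ means $X\le CY$ for some $C$ depending only on $\Omega$ and an upper bound of $C^B_{\mathcal D}$.
   Context: Setting. $\Omega\subset\mathbb R^d$ ($d\ge1$) is a bounded domain; $\mathcal S_d(\mathbb R)$ is the space of symmetric $d\times d$ matrices, $\xi:\phi=\sum_{i,j}\xi_{ij}\phi_{ij}$. A fourth order tensor $P=(p_{ijkl})$ acts by $(P\xi)_{ij}=\sum_{k,l}p_{ijkl}\xi_{kl}$, and $P^\tau=(p_{klij})$. $A=(a_{ijkl})$ has measurable bounded coefficients with $a_{ijkl}=a_{jikl}=a_{ijlk}=a_{klij}$, and $B$ is a fourth order tensor, constant over $\Omega$, such that $A\xi:\phi=B\xi:B\phi$ for all $\xi,\phi\in\mathcal S_d(\mathbb R)$, so $A=B^\tau B$. $\mathcal H$ is the Hessian, $\mathcal H^Bv=B\mathcal Hv$, and $\mathcal H:\xi=\sum_{i,j}\partial_{ij}\xi_{ij}$ for matrix-valued $\xi$. $\|\cdot\|$ is the $L^2(\Omega)$ norm (scalar, vector or matrix valued). Assume there is $\varrho>0$ with $\|\mathcal H^Bv\|\ge\varrho\|v\|_{H^2(\Omega)}$ for all $v\in H^2_0(\Omega)$.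 Set $a(u,v)=\int_\Omega\mathcal H^Bu:\mathcal H^Bv\,dx$. A $B$-Hessian discretisation is a quadruplet $\mathcal D=(X_{\mathcal D,0},\Pi_{\mathcal D},\nabla_{\mathcal D},\mathcal H^B_{\mathcal D})$ where $X_{\mathcal D,0}$ is a finite-dimensional real vector space and $\Pi_{\mathcal D}:X_{\mathcal D,0}\to L^2(\Omega)$, $\nabla_{\mathcal D}:X_{\mathcal D,0}\to L^2(\Omega)^d$, $\mathcal H^B_{\mathcal D}:X_{\mathcal D,0}\to L^2(\Omega;\mathbb R^{d\times d})$ are linear, with $\|\mathcal H^B_{\mathcal D}\cdot\|$ a norm on $X_{\mathcal D,0}$. Set $a_{\mathcal D}(u_{\mathcal D},v_{\mathcal D})=\int_\Omega\mathcal H^B_{\mathcal D}u_{\mathcal D}:\mathcal H^B_{\mathcal D}v_{\mathcal D}\,dx$. Accuracy measures: $C^B_{\mathcal D}=\max_{w\in X_{\mathcal D,0}\setminus\{0\}}\max\left(\frac{\|\Pi_{\mathcal D}w\|}{\|\mathcal H^B_{\mathcal D}w\|},\frac{\|\nabla_{\mathcal D}w\|}{\|\mathcal H^B_{\mathcal D}w\|}\right)$; for $\varphi\in H^2_0(\Omega)$, $S^B_{\mathcal D}(\varphi)=\min_{w\in X_{\mathcal D,0}}(\|\Pi_{\mathcal D}w-\varphi\|+\|\nabla_{\mathcal D}w-\nabla\varphi\|+\|\mathcal H^B_{\mathcal D}w-\mathcal H^B\varphi\|)$; for $\xi\in H^B(\Omega)=\{\xi\in L^2(\Omega)^{d\times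 d}:\mathcal H:B^\tau B\xi\in L^2(\Omega)\}$ and $w\in X_{\mathcal D,0}$, $\mathcal W^B_{\mathcal D}(\xi,w)=\int_\Omega\big((\mathcal H:B^\tau B\xi)\Pi_{\mathcal D}w-B\xi:\mathcal H^B_{\mathcal D}w\big)dx$ and $W^B_{\mathcal D}(\xi)=\max_{w\in X_{\mathcal D,0}\setminus\{0\}}\frac{|\mathcal W^B_{\mathcal D}(\xi,w)|}{\|\mathcal H^B_{\mathcal D}w\|}$; $\mathrm{WS}^B_{\mathcal D}(u)=W^B_{\mathcal D}(\mathcal Hu)+S^B_{\mathcal D}(u)$. *)

(* Defs.v *)
From HB Require Import structures.
From mathcomp Require Import all_boot all_order all_algebra.
From mathcomp Require Import all_classical all_reals all_analysis.

Set Implicit Arguments.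
Unset Strict Implicit.
Unset Printing Implicit Defensive.
Import Order.TTheory GRing.Theory Num.Theory.
Import numFieldNormedType.Exports.

Local Open Scope classical_set_scope.
Local Open Scope ring_scope.

(* Lebesgue measure on R^n = 'rV[R]_n. The sigma-algebra is the one generated
   by the coordinates (the Borel sigma-algebra), as for n.-tuple in the
   library; the measure is the n-fold product of the one-dimensional one. *)

Section measurable_rV.
Context (R : realType) (n : nat).

Let coords : 'I_n -> 'rV[R]_n -> R := fun i x => x ord0 i.

Let rV_set0 : g_sigma_preimage coords set0.
Proof. exact: sigma_algebra0. Qed.

Let rV_setC A : g_sigma_preimage coords A -> g_sigma_preimage coords (~` A).
Proof. exact: sigma_algebraC. Qed.

Let rV_bigcup (F : _^nat) : (forall i, g_sigma_preimage coords (F i)) ->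
  g_sigma_preimage coords (\bigcup_i (F i)).
Proof. exact: sigma_algebra_bigcup. Qed.

HB.instance Definition _ :=
  @isMeasurable.Build (measure_tuple_display default_measure_display)
    'rV[R]_n (g_sigma_preimage coords) rV_set0 rV_setC rV_bigcup.

End measurable_rV.

Lemma measurable_coord (R : realType) n (i : 'I_n) :
  measurable_fun setT (fun x : 'rV[R]_n => x ord0 i).
Proof.
move=> _ Y mY; rewrite setTI; apply: sub_sigma_algebra => /=.
rewrite -bigcup_seq/=; exists i => /=; first by rewrite mem_index_enum.
by exists Y => //; rewrite setTI.
Qed.

Lemma measurable_fun_rV d (T : measurableType d) (R : realType) n
    (f : T -> 'rV[R]_n) :
  (forall i, measurable_fun setT (fun t => f t ord0 i)) ->
  measurable_fun setT f.
Proof.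
move=> mf _ A mA; rewrite setTI.
pose coords : 'I_n -> 'rV[R]_n -> R := fun i x => x ord0 i.
suff : g_sigma_preimage (fun i => coords i \o f) `<=` measurable.
  by apply; rewrite g_sigma_preimage_comp; exists A => //; rewrite setTI.
apply: smallest_sub; first exact: sigma_algebra_measurable.
rewrite -bigcup_seq; apply: bigcup_sub => i _.
by move=> B [C mC <-]; exact: mf.
Qed.

Definition rV_cons (R : realType) n (p : measurableTypeR R * 'rV[R]_n) :
  'rV[R]_n.+1 := \row_i oapp (p.2 ord0) p.1 (unlift ord0 i).

Definition rV_uncons (R : realType) n (x : 'rV[R]_n.+1) :
  measurableTypeR R * 'rV[R]_n := (x ord0 ord0, \row_i x ord0 (lift ord0 i)).

Lemma rV_consK (R : realType) n : cancel (@rV_cons R n) (@rV_uncons R n).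
Proof.
move=> [a x]; congr pair; rewrite ?mxE ?unlift_none//.
by apply/rowP => i; rewrite !mxE liftK.
Qed.

Lemma measurable_rV_cons (R : realType) n : measurable_fun setT (@rV_cons R n).
Proof.
apply: measurable_fun_rV => i.
have [j ->|->] := unliftP ord0 i.
- rewrite (_ : (fun _ => _) = (fun x : 'rV[R]_n => x ord0 j) \o snd).
    exact: measurableT_comp (@measurable_coord R n j) measurable_snd.
  by apply/funext => p /=; rewrite mxE liftK.
- rewrite (_ : (fun _ => _) = fst); first exact: measurable_fst.
  by apply/funext => p /=; rewrite mxE unlift_none.
Qed.

Lemma measurable_rV_uncons (R : realType) n :
  measurable_fun setT (@rV_uncons R n).
Proof.
apply/measurable_fun_pairP; split; first exact: measurable_coord.
apply: measurable_fun_rV => i.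
rewrite (_ : (fun _ => _) = fun x : 'rV[R]_n.+1 => x ord0 (lift ord0 i)).
  exact: measurable_coord.
by apply/funext => p /=; rewrite mxE.
Qed.

Section prod_rV.
Context (R : realType) (n : nat).
Variable m : {sigma_finite_measure set 'rV[R]_n -> \bar R}.

Definition prod_rV : set 'rV[R]_n.+1 -> \bar R :=
  pushforward (@lebesgue_measure R \x m)%E (@rV_cons R n).

Let prod_rV0 : prod_rV set0 = 0%E.
Proof. by rewrite /prod_rV /pushforward preimage_set0 measure0. Qed.

Let prod_rV_ge0 A : (0 <= prod_rV A)%E.
Proof. by rewrite /prod_rV /pushforward; exact: measure_ge0. Qed.

Let mpreimage A : measurable A -> measurable (@rV_cons R n @^-1` A).
Proof.
by move=> mA; rewrite -[X in measurable X]setTI; exact: measurable_rV_cons.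
Qed.

Let prod_rV_sigma_additive : semi_sigma_additive prod_rV.
Proof.
move=> F mF tF mUF; rewrite /prod_rV /pushforward preimage_bigcup.
apply: measure_semi_sigma_additive.
- by move=> k; exact: mpreimage.
- apply/trivIsetP => /= i j _ _ ij; rewrite -preimage_setI.
  by move/trivIsetP : tF => /(_ _ _ _ _ ij) ->//; rewrite preimage_set0.
- by rewrite -preimage_bigcup; exact: mpreimage.
Qed.

HB.instance Definition _ := isMeasure.Build _ _ _ prod_rV
  prod_rV0 prod_rV_ge0 prod_rV_sigma_additive.

Let prod_rV_sigma_finite : sigma_finite setT prod_rV.
Proof.
have /sigma_finiteP[F [TF ndF Foo]] := sigma_finiteT (@lebesgue_measure R).
have /sigma_finiteP[G [TG ndG Goo]] := sigma_finiteT m.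
exists (fun k => @rV_uncons R n @^-1` (F k `*` G k)).
  rewrite -preimage_bigcup (_ : \bigcup_k _ = setT) ?preimage_setT//.
  rewrite -subTset => -[x y] _.
  have [[k _ Fk] [l _ Gl]] : (\bigcup_k F k) x /\ (\bigcup_k G k) y.
    by rewrite -TF -TG.
  exists (maxn k l) => //; split.
  - by move: x Fk; exact/subsetPset/ndF/leq_maxl.
  - by move: y Gl; exact/subsetPset/ndG/leq_maxr.
move=> k; have [mF Fk] := Foo k; have [mG Gk] := Goo k.
split.
  rewrite -[X in measurable X]setTI; apply: measurable_rV_uncons => //.
  exact: measurableX.
rewrite /prod_rV /pushforward -comp_preimage.
rewrite (_ : _ \o _ = id) ?preimage_id.
  by rewrite product_measure1E// lte_mul_pinfty// ge0_fin_numE.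
by apply/funext => p; exact: rV_consK.
Qed.

HB.instance Definition _ :=
  Measure_isSigmaFinite.Build _ _ _ prod_rV prod_rV_sigma_finite.

End prod_rV.

Fixpoint lebesgue_rV (R : realType) (n : nat) :
    {sigma_finite_measure set 'rV[R]_n -> \bar R} :=
  if n is n'.+1 then prod_rV (lebesgue_rV R n') else \d_(0 : 'rV[R]_0).

Definition dot (R : realType) m n (xi phi : 'M[R]_(m, n)) : R :=
  \sum_i \sum_j xi i j * phi i j.

Section L2.
Context (R : realType) (d : nat) (Omega : set 'rV[R]_d).

(* Elements of L^2(Omega) are represented by functions on R^d whose extension
   by 0 outside Omega is in L^2(R^d); two functions represent the same element
   when they are equal almost everywhere on Omega. *)
Definition ae_on (P : 'rV[R]_d -> Prop) : Prop :=
  {ae lebesgue_rV R d, forall x, Omega x -> P x}.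

Definition L2 (f : 'rV[R]_d -> R) : Prop :=
  f \_ Omega \in Lfun (lebesgue_rV R d) 2%:E.

Definition L2norm (f : 'rV[R]_d -> R) : R :=
  fine ('N[lebesgue_rV R d]_2%:E[EFin \o (f \_ Omega)])%E.

Definition L2mx m n (F : 'rV[R]_d -> 'M[R]_(m, n)) : Prop :=
  forall i j, L2 (fun x => F x i j).

Definition L2normmx m n (F : 'rV[R]_d -> 'M[R]_(m, n)) : R :=
  L2norm (fun x => Num.sqrt (dot (F x) (F x))).

Definition integral_on (f : 'rV[R]_d -> R) : R :=
  \int[lebesgue_rV R d]_(x in Omega) f x.

End L2.

Section Sobolev.
Context (R : realType) (d : nat).
Implicit Types (phi v g : 'rV[R]_d -> R) (xi : 'rV[R]_d -> 'M[R]_d).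

Definition partial (i : 'I_d) phi : 'rV[R]_d -> R :=
  fun x => 'D_(delta_mx ord0 i) phi x.

Definition partial2 phi : 'rV[R]_d -> 'M[R]_d :=
  fun x => \matrix_(i, j) partial i (partial j phi) x.

Fixpoint class_C (k : nat) phi : Prop :=
  continuous phi /\
  if k is k'.+1 then
    forall i, (forall x, derivable phi x (delta_mx ord0 i)) /\
              class_C k' (partial i phi)
  else True.

Variable Omega : set 'rV[R]_d.

Definition bounded_domain : Prop :=
  [/\ open Omega, connected Omega, Omega !=set0 & bounded_set Omega].

(* C_c^oo(Omega) *)
Definition test_function phi : Prop :=
  let supp := closure [set x | phi x != 0] in
  [/\ forall k, class_C k phi, compact supp & supp `<=` Omega].

Definition is_weak_partial (i : 'I_d) v g : Prop :=
  L2 Omega g /\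
  forall phi, test_function phi ->
    integral_on Omega (fun x => v x * partial i phi x) =
    - integral_on Omega (fun x => g x * phi x).

(* A representative of the weak derivative, which is unique up to equality
   almost everywhere on Omega; meaningful only when the latter exists in
   L^2(Omega). *)
Definition weak_partial (i : 'I_d) v : 'rV[R]_d -> R :=
  get [set g | is_weak_partial i v g].

Definition grad v : 'rV[R]_d -> 'rV[R]_d :=
  fun x => \row_i weak_partial i v x.

Definition hess v : 'rV[R]_d -> 'M[R]_d :=
  fun x => \matrix_(i, j) weak_partial i (weak_partial j v) x.

Definition H1 v : Prop :=
  L2 Omega v /\ forall i, exists g, is_weak_partial i v g.

Definition H2 v : Prop := H1 v /\ forall i, H1 (weak_partial i v).

Definition H2norm v : R :=
  Num.sqrt (L2norm Omega v ^+ 2 + L2normmx Omega (grad v) ^+ 2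
            + L2normmx Omega (hess v) ^+ 2).

(* The closure of C_c^oo(Omega) in H^2(Omega). *)
Definition H20 v : Prop :=
  H2 v /\
  forall e, 0 < e -> exists2 phi, test_function phi & H2norm (v \- phi) < e.

(* h = sum_(i, j) d_ij xi_ij in the sense of distributions, with h in L^2. *)
Definition is_divdiv xi (h : 'rV[R]_d -> R) : Prop :=
  L2 Omega h /\
  forall phi, test_function phi ->
    integral_on Omega (fun x => dot (xi x) (partial2 phi x)) =
    integral_on Omega (fun x => h x * phi x).

(* Same convention as for [weak_partial]. *)
Definition divdiv xi : 'rV[R]_d -> R := get [set h | is_divdiv xi h].

End Sobolev.

Section tensors.
Context (R : realType) (d : nat).

Definition tensor := 'I_d -> 'I_d -> 'I_d -> 'I_d -> R.

Implicit Types P : tensor.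

Definition tapp P (xi : 'M[R]_d) : 'M[R]_d :=
  \matrix_(i, j) \sum_k \sum_l P i j k l * xi k l.

Definition ttr P : tensor := fun i j k l => P k l i j.

Definition coefficient_tensor (Omega : set 'rV[R]_d) (A : 'rV[R]_d -> tensor) :
    Prop :=
  [/\ forall i j k l, measurable_fun Omega (fun x => A x i j k l),
      exists K, forall x i j k l, Omega x -> `|A x i j k l| <= K &
      forall x i j k l, Omega x ->
        [/\ A x i j k l = A x j i k l, A x i j k l = A x i j l k &
            A x i j k l = A x k l i j]].

Definition factorises (Omega : set 'rV[R]_d) (A : 'rV[R]_d -> tensor)
    (B : tensor) : Prop :=
  forall x (xi phi : 'M[R]_d), Omega x -> xi^T = xi -> phi^T = phi ->
    dot (tapp (A x) xi) phi = dot (tapp B xi) (tapp B phi).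

Variables (Omega : set 'rV[R]_d) (B : tensor).

Definition hessB (v : 'rV[R]_d -> R) : 'rV[R]_d -> 'M[R]_d :=
  fun x => tapp B (hess Omega v x).

Definition coercive (rho : R) : Prop :=
  forall v, H20 Omega v -> rho * H2norm Omega v <= L2normmx Omega (hessB v).

Definition form_a (u v : 'rV[R]_d -> R) : R :=
  integral_on Omega (fun x => dot (hessB u x) (hessB v x)).

End tensors.

Section discretisation.
Context (R : realType).

Definition is_norm (X : lmodType R) (N : X -> R) : Prop :=
  [/\ forall x y, N (x + y) <= N x + N y,
      forall (c : R) x, N (c *: x) = `|c| * N x &
      forall x, N x = 0 -> x = 0].

(* Linearity as a map into a space of functions modulo equality almost
   everywhere on Omega. *)
Definition ae_linear d (Omega : set 'rV[R]_d) (X V : lmodType R)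
    (F : X -> 'rV[R]_d -> V) : Prop :=
  forall (c : R) v w, ae_on Omega (fun x => F (c *: v + w) x = c *: F v x + F w x).

(* B enters only through the measures of accuracy below. *)
Record hessian_discretisation d (Omega : set 'rV[R]_d) := HessianDiscretisation {
  hd_space :> vectType R ;
  hd_Pi : hd_space -> 'rV[R]_d -> R ;
  hd_grad : hd_space -> 'rV[R]_d -> 'rV[R]_d ;
  hd_hess : hd_space -> 'rV[R]_d -> 'M[R]_d ;
  hd_Pi_L2 : forall w, L2 Omega (hd_Pi w) ;
  hd_grad_L2 : forall w, L2mx Omega (hd_grad w) ;
  hd_hess_L2 : forall w, L2mx Omega (hd_hess w) ;
  hd_Pi_linear : @ae_linear d Omega hd_space R^o hd_Pi ;
  hd_grad_linear : ae_linear Omega hd_grad ;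
  hd_hess_linear : ae_linear Omega hd_hess ;
  hd_hess_norm : is_norm (fun w => L2normmx Omega (hd_hess w))
}.

Context (d : nat) (Omega : set 'rV[R]_d) (B : tensor R d).
Variable D : hessian_discretisation Omega.
Implicit Types (w : D) (phi : 'rV[R]_d -> R) (xi : 'rV[R]_d -> 'M[R]_d).

Definition form_aD (u v : D) : R :=
  integral_on Omega (fun x => dot (hd_hess u x) (hd_hess v x)).

(* The suprema and the infimum below are attained, [D] being
   finite-dimensional; for D = 0 the suprema are [sup set0 = 0]. *)
Definition C_D : R :=
  sup [set Num.max (L2norm Omega (hd_Pi w) / L2normmx Omega (hd_hess w))
                   (L2normmx Omega (hd_grad w) / L2normmx Omega (hd_hess w))
      | w in [set w : D | w != 0]].

Definition S_D phi : R :=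
  inf [set L2norm Omega (hd_Pi w \- phi)
           + L2normmx Omega (hd_grad w \- grad Omega phi)
           + L2normmx Omega (hd_hess w \- hessB Omega B phi)
      | w in [set: D]].

(* [xi] is meant to be in H^B(Omega): L2mx Omega xi and some [h] satisfies
   [is_divdiv Omega (B^tau B xi) h], which [divdiv] then picks. *)
Definition limit_defect xi w : R :=
  integral_on Omega (fun x =>
    divdiv Omega (fun y => tapp (ttr B) (tapp B (xi y))) x * hd_Pi w x
    - dot (tapp B (xi x)) (hd_hess w x)).

Definition W_D xi : R :=
  sup [set `|limit_defect xi w| / L2normmx Omega (hd_hess w)
      | w in [set w : D | w != 0]].

Definition WS_D phi : R := W_D (hess Omega phi) + S_D phi.

End discretisation.

(* Main.v *)
Require Import Defs.
From HB Require Import structures.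
From mathcomp Require Import all_boot all_order all_algebra.
From mathcomp Require Import all_classical all_reals all_analysis.
From mathcomp Require Import measurable_realfun ring lra.

(** The estimate is an Aubin-Nitsche duality argument. Write
[e = u - Pi uD], [H] for the discrete Hessian, [HB v] for [B hess v], [W(v, w)]
for the limit defect of [hess v] at [w] and [W(v)] for its norm
[W_D B D (hess v)]. Since [g] is [e] divided by its norm, the norm of [e] is the
scalar product of [g] and [e]. By definition of the defect,

  (f, Pi w) = W(u, w) + (HB u, H w),  (g, Pi w) = W(phig, w) + (HB phig, H w)

for every discrete [w], as soon as the double divergences of [B^tau B hess u]
and [B^tau B hess phig] are [f] and [g]. Inserting these identities, the scheme
and the dual problem for [u] gives, with [w0 = P u - uD] ([dual_identity]),

  (g, e) = - W(phig, P u) - W(u, P phig) + W(phig, w0)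
           - (H (P phig) - HB phig, H w0)
           + (H (P u) - HB u, H (P phig) - HB phig).

The first two terms appear in the estimate. The last three are products of two
errors measured in the energy norm, because the energy norm of [w0] is at most
[|| H (P u) - HB u || + W(u)], as one sees by testing the scheme with [w0]
([energy_error_le]). The two terms in [w0] together, and the last term, are each
at most the product of the total errors, hence the constant 2.

Two facts are hidden in this computation.

The double divergence is a chosen representative of a weak derivative, so it has
to be identified almost everywhere. A test function must belong to the closure of
the test functions in [H2], with its classical second derivatives as weak ones:
that is integration by parts, which Fubini's theorem reduces to the fundamental
theorem of calculus ([integral_partial0]). And functions with the same integrals
against all test functions must agree almost everywhere ([fundamental_lemma]).
There, smooth functions of the form [1 - (1 - q)^n] increase to the indicator of
the set where [q] is positive, and such sets form a generating family that is
stable under intersection.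

The suprema [W_D] are finite because the discrete space has finite dimension:
the defect is a linear functional, represented by a discrete function for the
energy scalar product ([discrete_riesz]). *)

Set Implicit Arguments.
Unset Strict Implicit.
Unset Printing Implicit Defensive.
Import Order.TTheory GRing.Theory Num.Theory.
Import numFieldNormedType.Exports.

Local Open Scope classical_set_scope.
Local Open Scope ring_scope.

(** * Borel sets of the space of row vectors *)

Lemma ball_rV (R : realType) d (x y : 'rV[R]_d) r :
  ball x r y <-> 0 < r /\ forall i, `|x ord0 i - y ord0 i| < r.
Proof.
split=> [[r0 xy]|[r0 xy]]; split => // i; first exact: xy.
by rewrite ord1 => j; exact: xy.
Qed.

Lemma measurable_ball_rV (R : realType) d (x : 'rV[R]_d) r :
  measurable (ball x r).
Proof.
have [r0|r0] := ltP 0 r; last first.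
  rewrite (_ : ball x r = set0)//; apply/seteqP; split => // y /ball_rV[].
  by rewrite ltNge r0.
rewrite (_ : ball x r = \bigcap_(i in [set: 'I_d])
    (fun y : 'rV[R]_d => y ord0 i) @^-1` ball (x ord0 i) r).
  apply: fin_bigcap_measurable => // i _.
  rewrite -[X in measurable X]setTI; apply: measurable_coord => //.
  exact: measurable_ball.
apply/seteqP; split => y.
  by move=> /ball_rV[_ xy] i _; exact: xy.
by move=> xy; apply/ball_rV; split => // i; exact: xy.
Qed.

Lemma ratV_near (R : realType) d (x : 'rV[R]_d) (r : R) : 0 < r ->
  exists q : 'rV[rat]_d, ball (map_mx (@ratr R) q) r x.
Proof.
move=> r0.
have /choice[q qP] : forall i, exists q : rat, ball (x ord0 i) r (ratr q).
  move=> i.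
  have [] := @dense_rat R (ball (x ord0 i) r).
  - by exists (x ord0 i); exact: ballxx.
  - exact: ball_open.
  - by move=> z [xz [q _ qz]]; exists q; rewrite qz.
exists (\row_i q i); apply/ball_rV; split => // i.
by rewrite !mxE distrC; have := qP i.
Qed.

(** Rational centres and inverse integer radii give a countable family; a pair
whose closed ball leaves [U] receives the radius 0, hence an empty ball. That the
closed balls stay in [U] is what later puts the supports of bumps inside [U]. *)
Lemma open_rV_bigcup_ball (R : realType) d (U : set 'rV[R]_d) : open U ->
  exists (c : nat -> 'rV[R]_d) (r : nat -> R),
    (forall k, closed_ball (c k) (r k) `<=` U) /\
    U = \bigcup_k ball (c k) (r k).
Proof.
move=> oU.
pose C k : 'rV[R]_d * R := if @unpickle ('rV[rat]_d * nat)%type k is Some p then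
  (map_mx (@ratr R) p.1, p.2.+1%:R^-1) else (0, 0).
pose r k := if `[< closed_ball (C k).1 (C k).2 `<=` U >] then (C k).2 else 0.
have rU k : closed_ball (C k).1 (r k) `<=` U.
  by rewrite /r; case: ifPn => [/asboolP//|_]; rewrite closed_ball0.
exists (fst \o C), r; split; first exact: rU.
apply/seteqP; split => [x Ux|x [k _ xk]]; last first.
  by apply: (rU k); exact: subset_closed_ball.
have [e /= e0 xeU] : nbhs_ball x U by apply/nbhs_ballP; exact: open_nbhs_nbhs.
have [n ne] : exists n : nat, n.+1%:R^-1 < e / 2.
  have := near_infty_natSinv_lt (PosNum (divr_gt0 e0 (ltr0Sn R 1))).
  by case=> n _ /(_ n (leqnn n)); exists n.
have [q qx] := @ratV_near R d x n.+1%:R^-1 ltac:(by rewrite invr_gt0).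
exists (pickle (q, n)) => //=.
rewrite /r /C pickleK/= ifT//; apply/asboolP.
rewrite closed_ballE ?invr_gt0// => y qy; apply: xeU.
rewrite -ball_normE /ball_/=.
rewrite (_ : x - y = (x - map_mx (@ratr R) q) + (map_mx (@ratr R) q - y)); last first.
  by rewrite addrA subrK.
rewrite (le_lt_trans (ler_normD _ _))//.
move: qx; rewrite -ball_normE /ball_/= distrC => qx.
move: qy; rewrite /closed_ball_/= => qy; rewrite [ltRHS]splitr.
by rewrite ltr_leD// ?(lt_trans qx)// (le_trans qy)// ltW.
Qed.

Lemma open_measurable_rV (R : realType) d (U : set 'rV[R]_d) :
  open U -> measurable U.
Proof.
move=> /open_rV_bigcup_ball[c [r [_ ->]]].
by apply: bigcupT_measurable => k; exact: measurable_ball_rV.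
Qed.

Lemma continuous_measurable_rV (R : realType) d (f : 'rV[R]_d -> R) :
  continuous f -> measurable_fun setT f.
Proof.
move=> /continuousP cf; apply: (measurability _ (RGenOpens.measurableE R)).
move=> _ [_ [a [b ->] <-]]; rewrite setTI; apply: open_measurable_rV.
exact/cf/interval_open.
Qed.

(** * Integration of continuous functions with bounded support *)

(** Two functions that agree along two lines have the same difference quotients
there. This is how partial derivatives are computed after freezing coordinates. *)
Lemma derive_along (R : numFieldType) (V W : normedModType R)
    (f : V -> R) (g : W -> R) x v y w :
  (forall h : R, f (h *: v + x) = g (h *: w + y)) ->
  'D_v f x = 'D_w g y /\ (derivable f x v <-> derivable g y w).
Proof.
move=> fg; have fgx : f x = g y.
  by have := fg 0; rewrite !scale0r !add0r.
have E : (fun h => h^-1 *: ((f \o shift x) (h *: v) - f x)) =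
    (fun h => h^-1 *: ((g \o shift y) (h *: w) - g y)).
  by apply/funext => h /=; rewrite fg fgx.
by rewrite /derive /derivable E.
Qed.

Lemma continuous_rV (T : topologicalType) (R : realType) d (f : T -> 'rV[R]_d) :
  (forall i, continuous (fun t => f t ord0 i)) -> continuous f.
Proof.
move=> cf t; apply/cvg_ballP => e e0.
have : \forall s \near t, forall i, ball (f t ord0 i) e (f s ord0 i).
  by apply: filter_forall => i; apply: cvg_ball => //; exact: cf.
by apply: filterS => s fts; apply/ball_rV.
Qed.

Lemma rV_cons0 (R : realType) d (t : R) (y : 'rV[R]_d) :
  rV_cons (t, y) ord0 ord0 = t.
Proof. by rewrite mxE unlift_none. Qed.

Lemma rV_consS (R : realType) d (t : R) (y : 'rV[R]_d) i :
  rV_cons (t, y) ord0 (lift ord0 i) = y ord0 i.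
Proof. by rewrite mxE liftK. Qed.

Lemma continuous_rV_consl (R : realType) d (y : 'rV[R]_d) :
  continuous (fun t : R => rV_cons (t, y)).
Proof.
apply: continuous_rV => i; have [j ->|->] := unliftP ord0 i.
- by under eq_fun do rewrite rV_consS; exact: cst_continuous.
- by under eq_fun do rewrite rV_cons0; move=> t; exact: cvg_id.
Qed.

Lemma continuous_rV_consr (R : realType) d (t : R) :
  continuous (fun y : 'rV[R]_d => rV_cons (t, y)).
Proof.
apply: continuous_rV => i; have [j ->|->] := unliftP ord0 i.
- by under eq_fun do rewrite rV_consS; exact: coord_continuous.
- by under eq_fun do rewrite rV_cons0; exact: cst_continuous.
Qed.

Definition cube (R : realType) d (M : R) : set 'rV[R]_d :=
  [set x | forall i, `|x ord0 i| <= M].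

Lemma measurable_cube (R : realType) d (M : R) : measurable (@cube R d M).
Proof.
rewrite (_ : cube M = \bigcap_(i in [set: 'I_d])
    (fun y : 'rV[R]_d => y ord0 i) @^-1` `[- M, M]).
  apply: fin_bigcap_measurable => // i _.
  by rewrite -[X in measurable X]setTI; apply: measurable_coord.
apply/seteqP; split => y yM i.
  by move=> _ /=; rewrite in_itv/= -ler_norml.
by have := yM i Logic.I; rewrite /= in_itv/= -ler_norml.
Qed.

Lemma cube_compact (R : realType) d (M : R) : compact (@cube R d M).
Proof.
rewrite (_ : cube M = [set x : 'rV[R]_d | forall i, `[- M, M]%classic (x ord0 i)]).
  by apply: (@rV_compact _ _ (fun=> `[- M, M]%classic)) => _; exact: segment_compact.
by apply/seteqP; split => y yM i; have := yM i; rewrite /= in_itv/= -ler_norml.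
Qed.

Lemma lebesgue_cube_lty (R : realType) d (M : R) :
  (lebesgue_rV R d (@cube R d M) < +oo)%E.
Proof.
elim: d => [|d ih].
  by rewrite /= diracE ltry.
rewrite [X in (X < _)%E](_ : _ =
  ((@lebesgue_measure R \x lebesgue_rV R d) (`[(- M)%R, M] `*` cube M))%E); last first.
  rewrite /= /prod_rV /pushforward; congr (_ _).
  apply/seteqP; split => -[t y] /=.
  - move=> yM; split => [|i].
      by rewrite in_itv/= -ler_norml; have := yM ord0; rewrite rV_cons0.
    by have := yM (lift ord0 i); rewrite rV_consS.
  - move=> [+ yM] i; rewrite in_itv/= -ler_norml => tM.
    by have [j ->|->] := unliftP ord0 i; rewrite ?rV_cons0 ?rV_consS//; exact: yM.
rewrite product_measure1E//; last exact: measurable_cube.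
rewrite lte_mul_pinfty//.
by rewrite [X in X \is a _]lebesgue_measure_itv/=; case: ifPn.
Qed.

Lemma le_norm_rV (R : realType) d (x : 'rV[R]_d) i : `|x ord0 i| <= `|x|.
Proof.
rewrite [leRHS]/Num.norm/= mx_normrE; apply/bigmax_geP; right => /=.
by exists (ord0, i).
Qed.

Lemma bounded_cube (R : realType) d (A : set 'rV[R]_d) :
  bounded_set A -> exists M, A `<=` cube M.
Proof.
move=> [M [_ AM]]; exists (M + 1) => x Ax i.
by rewrite (le_trans (le_norm_rV _ _))//; apply: AM => //; rewrite ltrDl.
Qed.

Lemma bounded_lebesgue_lty (R : realType) d (A : set 'rV[R]_d) :
  measurable A -> bounded_set A -> (lebesgue_rV R d A < +oo)%E.
Proof.
move=> mA /bounded_cube[M AM]; apply: le_lt_trans (lebesgue_cube_lty d M).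
by apply: le_measure => //; rewrite inE//; exact: measurable_cube.
Qed.

Definition bounded_support (R : realType) d (f : 'rV[R]_d -> R) :=
  exists M, forall x, f x != 0 -> cube M x.

Lemma continuous_bounded_support_bounded (R : realType) d (f : 'rV[R]_d -> R) :
  continuous f -> bounded_support f -> exists K, forall x, `|f x| <= K.
Proof.
move=> cf [M fM].
have : bounded_set (f @` cube M).
  apply: compact_bounded; apply: continuous_compact; last exact: cube_compact.
  exact: continuous_subspaceT.
move=> [K [_ fK]]; exists (`|K| + 1) => x.
have [->|fx0] := eqVneq (f x) 0; first by rewrite normr0 addr_ge0.
apply: fK; first by rewrite ltr_pwDr// ler_norm.
by exists x => //; exact: fM.
Qed.

Lemma continuous_bounded_support_integrable (R : realType) d
    (f : 'rV[R]_d -> R) : continuous f -> bounded_support f ->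
  (lebesgue_rV R d).-integrable setT (EFin \o f).
Proof.
move=> cf /[dup] bf [M fM].
rewrite (_ : EFin \o f = (EFin \o f) \_ (cube M)); last first.
  apply/funext => x; rewrite patchE; case: ifPn => //= /negP xM.
  by congr EFin; apply/eqP/negPn/negP => /fM /mem_set.
apply: (integrable_mkcond (EFin \o f) (@measurable_cube R d M)).1.
apply: measurable_bounded_integrable.
- exact: measurable_cube.
- exact: lebesgue_cube_lty.
- by apply: measurable_funTS; exact: continuous_measurable_rV.
- have [K fK] := continuous_bounded_support_bounded cf bf.
  exists K; split; first exact: num_real.
  by move=> y Ky x _ /=; rewrite (le_trans (fK _))// ltW.
Qed.

Lemma integral_rV_cons (R : realType) d (F : 'rV[R]_d.+1 -> R) :
  continuous F -> bounded_support F ->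
  (@lebesgue_measure R \x lebesgue_rV R d)%E.-integrable setT
    (fun p => (F (rV_cons p))%:E) /\
  (\int[lebesgue_rV R d.+1]_x (F x)%:E =
   \int[(@lebesgue_measure R \x lebesgue_rV R d)%E]_p (F (rV_cons p))%:E)%E.
Proof.
move=> cF bF; have iF := continuous_bounded_support_integrable cF bF.
have mF : measurable_fun setT (EFin \o F).
  by apply/measurable_EFinP; exact: continuous_measurable_rV.
have i1 : (@lebesgue_measure R \x lebesgue_rV R d)%E.-integrable setT
    (fun p => (F (rV_cons p))%:E).
  apply/integrableP; split.
    by apply: (measurableT_comp mF); exact: measurable_rV_cons.
  move/integrableP : iF => [_]; rewrite /= /prod_rV.
  rewrite ge0_integral_pushforward//.
    exact: measurable_rV_cons.
  apply/measurable_EFinP; apply: measurableT_comp => //.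
  exact: continuous_measurable_rV.
split => //.
by rewrite /= /prod_rV integral_pushforward//; exact: measurable_rV_cons.
Qed.

(** The fundamental theorem of calculus on an interval larger than the support. *)
Lemma integral_deriv_bounded_support (R : realType) (g : R -> R) (M : R) :
  (forall t, derivable g t 1) -> continuous (fun t => 'D_1 g t) ->
  (forall t, g t != 0 -> `|t| <= M) ->
  (\int[@lebesgue_measure R]_t ('D_1 g t)%:E = 0)%E.
Proof.
move=> dg cdg gM.
pose N := `|M| + 1.
have MN : M < N by rewrite ltr_pwDr// ler_norm.
have N0 : 0 < N by rewrite ltr_wpDl.
have g0 t : M < `|t| -> g t = 0.
  by move=> Mt; apply/eqP/negPn/negP => /gM; rewrite leNgt Mt.
have dg0 t : M < `|t| -> 'D_1 g t = 0.
  move=> Mt.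
  transitivity ('D_1 (cst 0 : R -> R) t); last exact: derive_cst.
  apply: near_eq_derive.
  have : (Num.norm : R -> R) @ t --> `|t| by exact: norm_continuous.
  by move=> /cvgr_gt => /(_ _ Mt); apply: filterS => s /g0.
rewrite (_ : (fun t => ('D_1 g t)%:E) =
   ((fun t => ('D_1 g t)%:E) \_ `[- N, N]%classic)); last first.
  apply/funext => t; rewrite patchE; case: ifPn => // /negP tN.
  rewrite dg0//; rewrite (lt_trans MN)// ltNge; apply/negP => tN'.
  by apply: tN; rewrite inE/= in_itv/= -ler_norml.
rewrite -integral_mkcond (@continuous_FTC2 _ _ g).
- by rewrite !g0 ?normrN ?gtr0_norm// subee.
- by rewrite (lt_trans _ N0)// oppr_lt0.
- exact: continuous_subspaceT.
- have cg : continuous g.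
    by move=> t; apply: differentiable_continuous; apply/derivable1_diffP.
  split => //.
  + by apply: cvg_at_right_filter; exact: cg.
  + by apply: cvg_at_left_filter; exact: cg.
- by move=> t _; rewrite derive1E.
Qed.

(** Fubini's theorem lets one integrate first in the direction of
differentiation, where the fundamental theorem of calculus applies. The induction
on the dimension peels off the first coordinate, because the measure is an
iterated product in that order. *)
Lemma integral_partial0 (R : realType) d (f : 'rV[R]_d -> R) i :
  continuous f -> bounded_support f ->
  (forall x, derivable f x (delta_mx ord0 i)) -> continuous (partial i f) ->
  bounded_support (partial i f) ->
  (\int[lebesgue_rV R d]_x (partial i f x)%:E = 0)%E.
Proof.
elim: d => [|d ih] in f i *; first by case: i.
move=> cf [M fM] df cdf bdf.
have [idf ->] := integral_rV_cons cdf bdf.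
have consD0 t (y : 'rV[R]_d) h :
    rV_cons (h *: 1 + t, y) = h *: delta_mx ord0 ord0 + rV_cons (t, y) :> 'rV[R]_d.+1.
  apply/rowP => k; rewrite [RHS]mxE [in RHS]mxE [in RHS]mxE eqxx/=.
  have [j ->|->] := unliftP ord0 k.
    by rewrite !rV_consS eq_sym (negbTE (neq_lift _ _)) mulr0 add0r.
  by rewrite !rV_cons0 eqxx.
have consDS t (y : 'rV[R]_d) h j : rV_cons (t, h *: delta_mx ord0 j + y) =
    h *: delta_mx ord0 (lift ord0 j) + rV_cons (t, y) :> 'rV[R]_d.+1.
  apply/rowP => k; rewrite [RHS]mxE [in RHS]mxE [in RHS]mxE eqxx/=.
  have [l ->|->] := unliftP ord0 k.
    by rewrite !rV_consS !mxE eqxx/= (inj_eq lift_inj).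
  by rewrite !rV_cons0 (negbTE (neq_lift _ _)) mulr0 add0r.
have [j ij|i0] := unliftP ord0 i; subst i; last first.
- rewrite -integral21_prod_meas1//= /fubini_G.
  apply: integral0_eq => y _.
  pose g t := f (rV_cons (t, y)).
  have E t := @derive_along R R 'rV[R]_d.+1 g f t 1 (rV_cons (t, y)) (delta_mx ord0 ord0)
    (fun h => congr1 f (consD0 t y h)).
  have Eg : (fun t => 'D_1 g t) = (fun t => partial ord0 f (rV_cons (t, y))).
    by apply/funext => t; rewrite (E t).1.
  transitivity (\int[@lebesgue_measure R]_t ('D_1 g t)%:E)%E.
    by apply: eq_integral => t _; rewrite (E t).1.
  apply: (@integral_deriv_bounded_support _ _ M).
  + by move=> t; apply/(E t).2/df.
  + rewrite Eg => t; apply: continuous_comp; last exact: cdf.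
    exact: continuous_rV_consl.
  + by move=> t /fM /(_ ord0); rewrite rV_cons0.
- rewrite -integral12_prod_meas1//= /fubini_F.
  apply: integral0_eq => t _.
  pose g y := f (rV_cons (t, y)).
  have E y := @derive_along R 'rV[R]_d 'rV[R]_d.+1 g f y (delta_mx ord0 j)
    (rV_cons (t, y)) (delta_mx ord0 (lift ord0 j))
    (fun h => congr1 f (consDS t y h j)).
  have Eg : partial j g = (fun y => partial (lift ord0 j) f (rV_cons (t, y))).
    by apply/funext => y; rewrite /partial (E y).1.
  transitivity (\int[lebesgue_rV R d]_y (partial j g y)%:E)%E.
    by apply: eq_integral => y _; rewrite Eg.
  have cons_cont := @continuous_rV_consr R d t.
  apply: ih.
  + by move=> y; apply: continuous_comp; [exact: cons_cont|exact: cf].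
  + exists M => y /fM yM k.
    by have := yM (lift ord0 k); rewrite rV_consS.
  + by move=> y; apply/(E y).2; rewrite -/(partial _ _); apply: df.
  + by rewrite Eg => y; apply: continuous_comp; [exact: cons_cont|exact: cdf].
  + rewrite Eg; have [N bN] := bdf; exists N => y yN k.
    by have := bN _ yN (lift ord0 k); rewrite rV_consS.
Qed.

(** * Functions of class C^k and flat functions *)

Section class_C_theory.
Context (R : realType) (d : nat).
Implicit Types f g : 'rV[R]_d -> R.

Lemma class_C_continuous k f : class_C k f -> continuous f.
Proof. by case: k => [|k] []. Qed.

Lemma class_CW k f : class_C k.+1 f -> class_C k f.
Proof.
elim: k f => [|k ih] f [cf Cf]; split => // i.
by have [df Cdf] := Cf i; split => //; exact: ih.
Qed.

Lemma class_C_cst k (c : R) : class_C k (cst c : 'rV[R]_d -> R).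
Proof.
elim: k c => [|k ih] c; split => //; try exact: cst_continuous.
move=> i; split; first by move=> x; exact: derivable_cst.
rewrite (_ : partial i _ = cst 0); first exact: ih.
by apply/funext => x; exact: derive_cst.
Qed.

Lemma class_CD k f g : class_C k f -> class_C k g -> class_C k (f \+ g).
Proof.
elim: k f g => [|k ih] f g [cf Cf] [cg Cg]; split => //;
  try by move=> x; apply: continuousD; [exact: cf|exact: cg].
move=> i; have [df Cdf] := Cf i; have [dg Cdg] := Cg i; split.
  by move=> x; exact: derivableD.
rewrite (_ : partial i _ = partial i f \+ partial i g); first exact: ih.
by apply/funext => x; exact: deriveD.
Qed.

Lemma partialM i f g x : derivable f x (delta_mx ord0 i) ->
  derivable g x (delta_mx ord0 i) ->
  partial i (f \* g) x = partial i f x * g x + f x * partial i g x.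
Proof.
by move=> df dg; rewrite /partial deriveM// addrC /GRing.scale/= (mulrC (g x)).
Qed.

Lemma class_CM k f g : class_C k f -> class_C k g -> class_C k (f \* g).
Proof.
elim: k f g => [|k ih] f g Cf Cg.
  split => // x; have [cf _] := Cf; have [cg _] := Cg.
  by apply: continuousM; [exact: cf|exact: cg].
have [cf dCf] := Cf; have [cg dCg] := Cg; split.
  by move=> x; apply: continuousM; [exact: cf|exact: cg].
move=> i; have [df Cdf] := dCf i; have [dg Cdg] := dCg i; split.
  by move=> x; exact: derivableM.
rewrite (_ : partial i _ = (partial i f \* g) \+ (f \* partial i g)).
  by apply: class_CD; apply: ih => //; exact: class_CW.
by apply/funext => x; exact: partialM.
Qed.

Lemma class_CB k f g : class_C k f -> class_C k g -> class_C k (f \- g).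
Proof.
move=> Cf Cg; rewrite (_ : f \- g = f \+ (cst (- 1) \* g)).
  by apply: class_CD => //; apply: class_CM => //; exact: class_C_cst.
by apply/funext => x /=; rewrite mulN1r.
Qed.

Lemma class_CX k f n : class_C k f -> class_C k (fun x => f x ^+ n).
Proof.
move=> Cf; elim: n => [|n ih].
  by under eq_fun do rewrite expr0; exact: class_C_cst.
rewrite (_ : (fun _ => _) = f \* (fun x => f x ^+ n)); first exact: class_CM.
by apply/funext => x; rewrite exprS.
Qed.

Lemma class_C_prod k (I : Type) (s : seq I) (F : I -> 'rV[R]_d -> R) :
  (forall i, class_C k (F i)) -> class_C k (fun x => \prod_(i <- s) F i x).
Proof.
move=> CF; elim: s => [|i s ih].
  by under eq_fun do rewrite big_nil; exact: class_C_cst.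
rewrite (_ : (fun _ => _) = F i \* (fun x => \prod_(i <- s) F i x)).
  exact: class_CM.
by apply/funext => x; rewrite big_cons.
Qed.

End class_C_theory.

Section flat.
Context {R : realType}.

(** The function exp(-1/x) extended by 0 and its products with the powers of 1/x:
a family stable under differentiation, up to linear combinations, so that the
smoothness of all its members is one induction. *)
Definition flat (n : nat) (x : R) : R :=
  if 0 < x then x ^- n * expR (- x^-1) else 0.

Lemma flat_ge0 n x : 0 <= flat n x.
Proof.
by rewrite /flat; case: ifPn => // x0; rewrite mulr_ge0 ?expR_ge0 ?invr_ge0 ?exprn_ge0 ?ltW.
Qed.

Lemma flat_le1 x : flat 0 x <= 1.
Proof.
rewrite /flat; case: ifPn => // x0; rewrite expr0 invr1 mul1r -expR0 ler_expR.
by rewrite oppr_le0 invr_ge0 ltW.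
Qed.

Lemma flat_gt0 x : (0 < flat 0 x) = (0 < x).
Proof.
rewrite /flat; case: ifPn => [x0|_]; last by rewrite ltxx.
by rewrite expr0 invr1 mul1r expR_gt0.
Qed.

(** Write exp(y) as the n-th power of exp(y/n), which is at least y/n. *)
Lemma exprn_le_expR n (y : R) : 0 <= y -> y ^+ n <= n%:R ^+ n * expR y.
Proof.
move=> y0; case: n => [|n]; first by rewrite !expr0 mul1r -expR0 ler_expR.
have -> : y = n.+1%:R * (y / n.+1%:R).
  by rewrite mulrC divfK// pnatr_eq0.
rewrite exprMn expRM_natl ler_pM2l ?exprn_gt0//.
rewrite lerXn2r ?nnegrE ?divr_ge0 ?expR_ge0//.
by apply: le_trans (expR_ge1Dx _); rewrite lerDr.
Qed.

(** The quadratic bound makes the function differentiable at the origin, with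
derivative 0. *)
Lemma flat_le_sqr n x : flat n x <= n.+2%:R ^+ n.+2 * x ^+ 2.
Proof.
rewrite /flat; case: ifPn => [x0|_]; last first.
  by apply: mulr_ge0; [exact: exprn_ge0|exact: sqr_ge0].
have xV0 : 0 <= x^-1 by rewrite invr_ge0 ltW.
have := @exprn_le_expR n.+2 _ xV0.
rewrite expRN -ler_pdivrMr ?expR_gt0// => /(ler_wpM2r (sqr_ge0 x)).
have E : x^-1 ^+ n.+2 * x ^+ 2 = x ^- n.
  by rewrite -[n.+2]addn2 exprD -mulrA -exprMn mulVf ?gt_eqF// expr1n mulr1 exprVn.
by rewrite mulrAC E.
Qed.

Lemma is_derive_flat n (x : R) :
  is_derive (x : R) 1 (flat n) (flat n.+2 x - n%:R * flat n.+1 x).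
Proof.
have [x0|x0|->] := ltgtP x 0.
- rewrite {2 3}/flat !ifF ?mulr0 ?subr0; try by rewrite lt_gtF.
  apply: (near_eq_is_derive _ (is_derive_cst (0 : R) x 1)).
  have : id y @[y --> x] --> x by exact: cvg_id.
  by move=> /cvgr_lt => /(_ _ x0); apply: filterS => y y0; rewrite /flat lt_gtF.
- apply: (@near_eq_is_derive _ _ _ (fun y : R => y^-1 ^+ n * expR (- y^-1))).
    have : id y @[y --> x] --> x by exact: cvg_id.
    by move=> /cvgr_gt => /(_ _ x0); apply: filterS => y y0; rewrite /flat y0 exprVn.
  have dV : is_derive x 1 (fun y : R => y^-1) (- x ^- 2).
    apply: is_derive_eq; first by apply: is_deriveV; rewrite gt_eqF.
    by rewrite /GRing.scale/= mulr1.
  have dE : is_derive x 1 (fun y : R => expR (- y^-1)) (expR (- x^-1) * x ^- 2).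
    apply: (@is_derive1_comp _ expR (fun y => - y^-1)).
    by rewrite -[x ^- 2]opprK; exact: is_deriveN.
  have dX : is_derive x 1 (fun y : R => y^-1 ^+ n) (- (n%:R * x^-1 ^+ n.+1)).
    have := @is_deriveX _ _ _ n _ _ _ dV; rewrite (_ : _ ^+ n = (fun y : R => y^-1 ^+ n)).
      move=> h; apply: is_derive_eq h _; rewrite /GRing.scale/= mulrN; congr (- _).
      case: n => [|m]; first by rewrite !mul0r.
      by rewrite -mulrA -exprVn -exprD addn2.
    by apply/funext => y; rewrite exprfctE.
  apply: is_derive_eq (is_deriveM dX dE) _.
  rewrite /flat x0 /GRing.scale/= -!exprVn !exprS expr0; ring.
- have cv : (fun h : R => h^-1 *: ((flat n \o shift 0) (h *: 1) - flat n 0))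
      @ 0^' --> (0 : R).
    pose C := n.+2%:R ^+ n.+2 : R.
    have C0 : 0 <= C by rewrite exprn_ge0.
    have Ch : C * `|h| @[h --> (0 : R)^'] --> (0 : R).
      have H : C * `|h| @[h --> (0 : R)^'] --> C * `|0 : R|.
        apply: (@cvg_within_filter _ _ (fun h : R => C * `|h|)).
        by apply: cvgMr; exact: norm_continuous.
      by move: H; rewrite (@normr0 _ R) mulr0.
    apply: (@squeeze_cvgr _ _ _ _ (fun h => - (C * `|h|)) (fun h => C * `|h|)).
    + apply: nearW => h /=; rewrite -ler_norml addr0 /GRing.scale/= mulr1.
      rewrite {2}/flat ltxx subr0 normrM normfV (ger0_norm (flat_ge0 _ _)).
      have [->|h0] := eqVneq h 0; first by rewrite normr0 invr0 mul0r mulr0.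
      by rewrite ler_pdivrMl ?normr_gt0// mulrCA -expr2 real_normK ?num_real// flat_le_sqr.
    + have := cvgN Ch; rewrite oppr0 => H; exact: H.
    + exact: Ch.
  have -> : flat n.+2 0 - n%:R * flat n.+1 0 = 0 :> R.
    by rewrite /flat ltxx mulr0 subr0.
  by split; [exact: cvgP cv|exact: cvg_lim cv].
Qed.

End flat.

(** * Test functions *)

Lemma is_derive_flat_affine (R : realType) n (e c t : R) :
  is_derive t 1 (fun s : R => flat n (e * s + c))
    (e * (flat n.+2 (e * t + c) - n%:R * flat n.+1 (e * t + c))).
Proof.
rewrite mulrC; apply: (@is_derive1_comp _ (flat n) (fun s : R => e * s + c)).
  exact: is_derive_flat.
have : is_derive t 1 (e *: (@id R) + cst c) (e *: 1 + 0).
  by apply: is_deriveD.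
by rewrite addr0 /GRing.scale/= mulr1.
Qed.

Lemma class_C_flat (R : realType) d k n (i : 'I_d) (e c : R) :
  class_C k (fun x : 'rV[R]_d => flat n (e * x ord0 i + c)).
Proof.
have cont m : continuous (fun x : 'rV[R]_d => flat m (e * x ord0 i + c)).
  move=> x; apply: (@continuous_comp _ _ _ (fun x : 'rV[R]_d => x ord0 i)
    (fun s : R => flat m (e * s + c))); first exact: coord_continuous.
  apply: differentiable_continuous; apply/derivable1_diffP.
  by have [] := @is_derive_flat_affine R m e c (x ord0 i).
elim: k n => [|k ih] n; split => //.
move=> j.
have [<-|ij] := eqVneq i j.
- have E (x : 'rV[R]_d) := @derive_along R _ _
    (fun x : 'rV[R]_d => flat n (e * x ord0 i + c))
    (fun s : R => flat n (e * s + c)) x (delta_mx ord0 i) (x ord0 i) 1.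
  have E1 (x : 'rV[R]_d) h : flat n (e * (h *: delta_mx ord0 i + x) ord0 i + c) =
     flat n (e * (h *: (1 : R) + x ord0 i) + c).
    by rewrite !mxE !eqxx.
  split; first by move=> x; apply/(E x (E1 x)).2;
    have [] := @is_derive_flat_affine R n e c (x ord0 i).
  rewrite (_ : partial _ _ = cst e \*
    ((fun x => flat n.+2 (e * x ord0 i + c)) \-
     (cst n%:R \* (fun x => flat n.+1 (e * x ord0 i + c))))).
    apply: class_CM; first exact: class_C_cst.
    apply: class_CB => //; apply: class_CM => //; exact: class_C_cst.
  apply/funext => x; rewrite /partial (E x (E1 x)).1.
  by have [_ ->] := @is_derive_flat_affine R n e c (x ord0 i).
- have E (x : 'rV[R]_d) := @derive_along R _ _
    (fun x : 'rV[R]_d => flat n (e * x ord0 i + c))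
    (cst (flat n (e * x ord0 i + c)) : R -> R) x (delta_mx ord0 j) 0 1.
  have E1 (x : 'rV[R]_d) (h : R) : flat n (e * (h *: delta_mx ord0 j + x) ord0 i + c) =
      cst (flat n (e * x ord0 i + c)) (h *: (1 : R) + 0).
    by rewrite !mxE eqxx/= (negbTE ij) mulr0 add0r.
  split; first by move=> x; apply/(E x (E1 x)).2; exact: derivable_cst.
  rewrite (_ : partial _ _ = cst 0); first exact: class_C_cst.
  by apply/funext => x; rewrite /partial (E x (E1 x)).1 derive_cst.
Qed.

Definition smooth (R : realType) d (f : 'rV[R]_d -> R) := forall k, class_C k f.

(** The balls of the sup norm are cubes, so a product over the coordinates of
one-dimensional bumps is positive exactly on a ball. *)
Definition bump (R : realType) d (c : 'rV[R]_d) (r : R) (x : 'rV[R]_d) : R :=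
  \prod_(i < d) (flat 0 (1 * x ord0 i + (r - c ord0 i)) *
                 flat 0 (- 1 * x ord0 i + (r + c ord0 i))).

Lemma smooth_bump (R : realType) d (c : 'rV[R]_d) r : smooth (bump c r).
Proof.
move=> k; apply: class_C_prod => i.
by apply: class_CM; exact: class_C_flat.
Qed.

Lemma bump_ge0 (R : realType) d (c : 'rV[R]_d) r x : 0 <= bump c r x.
Proof. by apply: prodr_ge0 => i _; rewrite mulr_ge0 ?flat_ge0. Qed.

Lemma bump_le1 (R : realType) d (c : 'rV[R]_d) r x : bump c r x <= 1.
Proof.
by apply: prodr_ile1 => i _; rewrite mulr_ge0 ?flat_ge0// mulr_ile1 ?flat_ge0 ?flat_le1.
Qed.

Lemma flat_neq0 (R : realType) (x : R) : (flat 0 x != 0) = (0 < x).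
Proof. by rewrite -flat_gt0 lt0r flat_ge0 andbT. Qed.

Lemma bump_neq0 (R : realType) d (c : 'rV[R]_d) r x : (0 < d)%N ->
  (bump c r x != 0) <-> ball c r x.
Proof.
move=> d0; split.
- move=> /prodf_neq0 b0; have {}b0 i : `|c ord0 i - x ord0 i| < r.
    have := b0 i isT; rewrite mulf_eq0 negb_or => /andP[].
    by rewrite !flat_neq0 ltr_norml => ? ?; apply/andP; split; lra.
  apply/ball_rV; split => //.
  by apply: le_lt_trans (b0 (Ordinal d0)).
- move=> /ball_rV[r0 xr]; apply/prodf_neq0 => i _; have := xr i.
  rewrite ltr_norml mulf_eq0 negb_or !flat_neq0 => /andP[? ?].
  by apply/andP; split; lra.
Qed.

Section test_functions.
Context (R : realType) (d : nat) (Omega : set 'rV[R]_d).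
Implicit Types f g : 'rV[R]_d -> R.

Definition support f := closure [set x | f x != 0].

Lemma test_function_supported f g : test_function Omega f -> smooth g ->
  (forall x, g x != 0 -> support f x) -> test_function Omega g.
Proof.
move=> [Cf kf fO] Cg gf.
have sgf : support g `<=` support f.
  have := closure_subset (gf : [set x | g x != 0] `<=` support f).
  by rewrite -[X in _ `<=` X -> _](closure_id _).1//; exact: closed_closure.
split => //; first exact: (subclosed_compact (@closed_closure _ _) kf).
exact: subset_trans sgf fO.
Qed.

Lemma test_function0 : test_function Omega (cst 0).
Proof.
split; first by move=> k; exact: class_C_cst.
all: rewrite (_ : [set x : 'rV[R]_d | _] = set0) ?closure0//;
  try exact: compact0; by apply/seteqP; split => x //=; rewrite eqxx.
Qed.

Lemma test_function_smooth f : test_function Omega f -> smooth f.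
Proof. by case. Qed.

Lemma partial_eq0 i f x : ~ support f x -> partial i f x = 0.
Proof.
move=> xf; rewrite /partial.
transitivity ('D_(delta_mx ord0 i) (cst 0 : 'rV[R]_d -> R) x);
  last exact: derive_cst.
apply: near_eq_derive.
have : open_nbhs x (~` support f).
  by split => //; apply: closed_openC; exact: closed_closure.
move=> /open_nbhs_nbhs; apply: filterS => y yf /=.
by apply/eqP/negPn/negP => fy; apply: yf; exact: subset_closure.
Qed.

Lemma test_function_partial i f : test_function Omega f ->
  test_function Omega (partial i f).
Proof.
move=> tf; apply: (test_function_supported tf).
  by move=> k; have [Cf _ _] := tf; have [_ /(_ i)[]] := Cf k.+1.
move=> x; apply: contraPP => /partial_eq0 -> /=.
by move=> /eqP.
Qed.

Lemma test_function_derivable i f x : test_function Omega f ->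
  derivable f x (delta_mx ord0 i).
Proof. by move=> [Cf _ _]; have [_ /(_ i)[+ _]] := Cf 1%N; exact. Qed.

Lemma test_function_continuous f : test_function Omega f -> continuous f.
Proof. by move=> [/(_ 0%N) /class_C_continuous]. Qed.

Lemma test_function_bounded_support f : test_function Omega f ->
  bounded_support f.
Proof.
move=> [_ kf _]; have [M fM] := bounded_cube (compact_bounded kf).
by exists M => x fx; apply: fM; exact: subset_closure.
Qed.

Lemma test_function_outside f x : test_function Omega f -> ~ Omega x -> f x = 0.
Proof.
move=> [_ _ fO] Ox; apply/eqP/negPn/negP => fx; apply: Ox.
by apply: fO; exact: subset_closure.
Qed.

Lemma test_functionM f g : test_function Omega f -> smooth g ->
  test_function Omega (f \* g).
Proof.
move=> tf sg; apply: (test_function_supported tf).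
  by move=> k; apply: class_CM => //; exact: test_function_smooth.
by move=> x /=; rewrite mulf_eq0 negb_or => /andP[fx _]; exact: subset_closure.
Qed.

(** The support is the closed ball, which is compact in finite dimension. *)
Lemma test_function_bump (c : 'rV[R]_d) (r : R) : (0 < d)%N ->
  closed_ball c r `<=` Omega -> test_function Omega (bump c r).
Proof.
move=> d0 cO; have E : [set x | bump c r x != 0] = ball c r.
  by apply/seteqP; split => x /(bump_neq0 _ _ _ d0).
split; rewrite ?E//; first exact: smooth_bump.
have [r0|r0] := ltP 0 r; last first.
  by rewrite -/(closed_ball c r) closed_ball0//; exact: compact0.
apply: bounded_closed_compact; last exact: closed_closure.
rewrite -/(closed_ball c r) closed_ballE//; exists (`|c| + r); split.
  exact: num_real.
move=> M cM x; rewrite /closed_ball_/= => cx; apply: le_trans (ltW cM).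
rewrite -[x](subrK c) addrC (le_trans (ler_normD _ _))// lerD2l.
by rewrite distrC.
Qed.

(** The product of two test functions is a test function; Leibniz' rule turns
the vanishing integral of its partial derivative into integration by parts. *)
Lemma integral_partial_test f g i : test_function Omega f ->
  test_function Omega g ->
  (\int[lebesgue_rV R d]_x (partial i f x * g x + f x * partial i g x)%:E = 0)%E.
Proof.
move=> tf tg; have tfg := test_functionM tf (test_function_smooth tg).
have E : partial i (f \* g) = (fun x => partial i f x * g x + f x * partial i g x).
  by apply/funext => x; apply: partialM; exact: test_function_derivable.
have tp := test_function_partial i tfg.
have := @integral_partial0 R d (f \* g) i.
rewrite E; apply.
- exact: test_function_continuous.
- exact: test_function_bounded_support.
- by move=> x; exact: test_function_derivable.
- by rewrite -E; exact: test_function_continuous.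
- by rewrite -E; exact: test_function_bounded_support.
Qed.

End test_functions.

(** * The fundamental lemma of the calculus of variations *)

Section fundamental_lemma.
Context (R : realType) (d : nat) (Omega : set 'rV[R]_d).
Local Notation mu := (lebesgue_rV R d).
Implicit Types (b q w : 'rV[R]_d -> R).

Definition positivity_set b := [set x | 0 < b x].

Definition unit_valued b := forall x, 0 <= b x <= 1.

Lemma measurable_positivity_set b :
  continuous b -> measurable (positivity_set b).
Proof.
move=> cb; apply: open_measurable_rV.
rewrite (_ : positivity_set b = b @^-1` [set t | 0 < t]) //.
by move/continuousP : cb; apply; exact: open_gt.
Qed.

Lemma positivity_setM b q : unit_valued b -> unit_valued q ->
  positivity_set (b \* q) = positivity_set b `&` positivity_set q.
Proof.
move=> ub uq; apply/seteqP; split => x; rewrite /positivity_set /=.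
  have /andP[b0 _] := ub x; have /andP[q0 _] := uq x.
  rewrite !lt0r b0 q0 !andbT mulr_ge0// andbT mulf_eq0 negb_or.
  by move=> /andP[-> ->].
by move=> [? ?]; exact: mulr_gt0.
Qed.

Variable w : 'rV[R]_d -> R.
Hypothesis iw : mu.-integrable setT (EFin \o w).
Hypothesis w0 : forall phi, test_function Omega phi ->
  (\int[mu]_x (w x * phi x)%:E = 0)%E.

(** The functions [1 - (1 - q)^n] are test functions, and they increase to the
indicator of the set where [q] is positive; pass to the limit by dominated
convergence. *)
Lemma integral_positivity_set q : test_function Omega q -> unit_valued q ->
  (\int[mu]_(x in positivity_set q) (w x)%:E = 0)%E.
Proof.
move=> tq uq.
have cq := test_function_continuous tq.
have mw : measurable_fun setT w by apply/measurable_EFinP; exact: measurable_int iw.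
pose phi n x := 1 - (1 - q x) ^+ n.
have tphi n : test_function Omega (phi n).
  apply: (test_function_supported tq).
    move=> k; apply: class_CB; first exact: class_C_cst.
    apply: (@class_CX _ _ _ (cst 1 \- q)); apply: class_CB; first exact: class_C_cst.
    exact: (test_function_smooth tq).
  move=> x; rewrite /phi => phix; apply: subset_closure => /=.
  by apply: contraNN phix => /eqP ->; rewrite subr0 expr1n subrr.
have uphi n x : 0 <= phi n x <= 1.
  have /andP[q0 q1] := uq x.
  rewrite /phi subr_ge0 exprn_ile1 ?subr_ge0//=; last by rewrite gerBl.
  by rewrite gerBl exprn_ge0// subr_ge0.
have cvgf : forall x, [set: 'rV[R]_d] x -> (w x * phi n x)%:E @[n --> \oo] -->
    ((EFin \o w) \_ (positivity_set q)) x.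
  move=> x _; have /andP[q0 q1] := uq x.
  rewrite patchE; case: ifPn => [/set_mem /= qx|/negP qx].
    apply: cvg_EFin; first by apply: nearW.
    rewrite [X in _ --> X](_ : _ = w x * (1 - 0)); last by rewrite subr0 mulr1.
    apply: cvgMr; apply: cvgB; first exact: cvg_cst.
    apply: cvg_expr; rewrite ger0_norm ?subr_ge0// ltrBlDr ltrDl.
    exact: qx.
  have qx0 : q x = 0.
    apply/eqP; rewrite eq_le q0 andbT leNgt; apply/negP => qx1; apply: qx.
    exact/mem_set.
  under eq_fun do rewrite /phi qx0 subr0 expr1n subrr mulr0.
  exact: cvg_cst.
rewrite integral_mkcond.
have := @dominated_cvg _ _ _ mu setT measurableT
  (fun n x => (w x * phi n x)%:E) ((EFin \o w) \_ (positivity_set q))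
  (fun x => `|w x|%:E) _ cvgf.
have -> : (fun n => \int[mu]_x (w x * phi n x)%:E)%E = cst 0%E.
  by apply/funext => n; exact: w0.
move=> h.
have /cvg_lim <- : cst 0%E x @[x --> \oo] -->
    (\int[mu]_x ((EFin \o w) \_ (positivity_set q)) x)%E.
  apply: h => //.
  - move=> n; apply/measurable_EFinP; apply: measurable_funM => //.
    exact: (continuous_measurable_rV (test_function_continuous (tphi n))).
  - by have := integrable_abse iw.
  - move=> n x _; rewrite lee_fin normrM ler_piMr//.
    by have /andP[? ?] := uphi n x; rewrite ger0_norm.
- exact: lim_cst.
- exact: ereal_hausdorff.
Qed.

(** Dynkin's argument. The positivity sets of smooth functions with values in
[[0, 1]] are stable under intersection, as the functions can be multiplied, and
they generate the Borel sets, as they contain the half-spaces. Multiplying by [q]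
makes these functions test functions. *)
Lemma integral_below_test q E : test_function Omega q -> unit_valued q ->
  measurable E -> (\int[mu]_(x in E `&` positivity_set q) (w x)%:E = 0)%E.
Proof.
move=> tq uq mE.
have mq : measurable (positivity_set q).
  exact: (measurable_positivity_set (test_function_continuous tq)).
pose G := [set A | exists b, [/\ smooth b, unit_valued b & A = positivity_set b]].
pose H := [set A | measurable A /\
  (\int[mu]_(x in A `&` positivity_set q) (w x)%:E = 0)%E].
have GI : setI_closed G.
  move=> _ _ [b [sb ub ->]] [c [sc uc ->]]; exists (b \* c); split.
  - by move=> k; exact: class_CM.
  - move=> x; have /andP[? ?] := ub x; have /andP[? ?] := uc x => /=.
    by rewrite mulr_ge0//= mulr_ile1.
  - by rewrite positivity_setM.
have GH : G `<=` H.
  move=> _ [b [sb ub ->]]; split.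
    by apply: measurable_positivity_set; exact: class_C_continuous (sb 0%N).
  rewrite setIC -positivity_setM//; apply: integral_positivity_set.
    exact: test_functionM.
  move=> x; have /andP[? ?] := ub x; have /andP[? ?] := uq x => /=.
  by rewrite mulr_ge0//= mulr_ile1.
have iwS A : measurable A -> mu.-integrable A (EFin \o w).
  by move=> mA; apply: integrableS iw.
have HT : H setT.
  by split => //; rewrite setTI; exact: integral_positivity_set.
have dH : dynkin H.
  split => //.
  - move=> A [mA A0]; split; first exact: measurableC.
    have [_] := HT; rewrite -(setUCr A) setIUl integral_setU.
    + by rewrite A0 add0e.
    + exact: measurableI.
    + by apply: measurableI => //; exact: measurableC.
    + apply: measurable_int; apply: iwS.
      by apply: measurableU; apply: measurableI => //; exact: measurableC.
    + by rewrite disj_set2E setIACA setICr set0I.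
  - move=> F tF HF; split; first by apply: bigcupT_measurable => n; have [] := HF n.
    rewrite setI_bigcupl integral_bigcup.
    + by apply: eseries0 => n _ _; have [] := HF n.
    + apply/trivIsetP => i j _ _ ij.
      move/trivIsetP : tF => /(_ i j Logic.I Logic.I ij).
      by rewrite setIACA => ->; rewrite set0I.
    + by move=> k; apply: measurableI => //; have [] := HF k.
    + apply: iwS; apply: bigcupT_measurable => k; apply: measurableI => //.
      by have [] := HF k.
have GsH : <<s G >> `<=` H.
  rewrite -setI_closed_g_dynkin_g_sigma_algebra//.
  exact: smallest_sub.
suff sG : measurable `<=` <<s G >> by have [] := GsH _ (sG _ mE).
apply: smallest_sub; first exact: smallest_sigma_algebra.
rewrite -bigcup_seq; apply: bigcup_sub => i _ /= _ [Y mY <-].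
suff : @measurable_fun _ _ (g_sigma_algebraType G) R setT (fun x => x ord0 i).
  by move=> /(_ measurableT _ mY).
apply: (measurability _ (RGenOInfty.measurableE R)).
move=> _ [_ [a ->] <-]; rewrite setTI; apply: sub_sigma_algebra.
exists (fun x => flat 0 (1 * x ord0 i + - a)); split.
- by move=> k; exact: class_C_flat.
- by move=> x; rewrite flat_ge0 flat_le1.
- apply/seteqP; split => x;
    by rewrite /positivity_set/= flat_gt0 in_itv/= andbT mul1r subr_gt0.
Qed.

(** Locally, on the positivity set of a bump, the integral of [w] over every Borel
set vanishes; countably many such sets cover an open set. *)
Lemma fundamental_lemma : open Omega -> (0 < d)%N ->
  {ae mu, forall x, Omega x -> w x = 0}.
Proof.
move=> oO d0; have [c [r [cO ->]]] := open_rV_bigcup_ball oO.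
suff : forall k, {ae mu, forall x, ball (c k) (r k) x -> w x = 0}.
  by move=> /ae_foralln; apply: filterS => x wx [k _ ck]; exact: wx ck.
move=> k; pose q := bump (c k) (r k).
have tq : test_function Omega q by exact: test_function_bump.
have uq : unit_valued q by move=> x; rewrite bump_ge0 bump_le1.
have qE : ball (c k) (r k) = positivity_set q.
  apply/seteqP; split => x; rewrite /positivity_set/= lt0r bump_ge0 andbT.
    by move/(bump_neq0 _ _ _ d0).
  by move/(bump_neq0 _ _ _ d0).
rewrite qE.
have mq : measurable (positivity_set q).
  exact: (measurable_positivity_set (test_function_continuous tq)).
have := @integral_ae_eq _ _ _ mu (positivity_set q) mq (cst 0%E) (EFin \o w).
have iwq : mu.-integrable (positivity_set q) (EFin \o w) by apply: integrableS iw.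
move=> /(_ iwq (measurable_cst _)) h.
have : ae_eq mu (positivity_set q) (EFin \o w) (cst 0%E).
  apply: h => E Eq mE; rewrite integral0 -(setIidl Eq).
  exact: integral_below_test.
by apply: filterS => x h1 /h1 [].
Qed.

End fundamental_lemma.

(** * Square integrable functions *)

Section L2_theory.
Context (R : realType) (d : nat) (Omega : set 'rV[R]_d).
Hypothesis mO : measurable Omega.
Local Notation mu := (lebesgue_rV R d).
Implicit Types f g h : 'rV[R]_d -> R.

Lemma ae_onS (P Q : 'rV[R]_d -> Prop) :
  (forall x, P x -> Q x) -> ae_on Omega P -> ae_on Omega Q.
Proof. by move=> PQ; rewrite /ae_on; apply: filterS => x h /h /PQ. Qed.

Lemma L2norm_ge0 f : 0 <= L2norm Omega f.
Proof. by rewrite /L2norm fine_ge0 ?Lnorm_ge0. Qed.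

(** When the integral is infinite, both sides are 0, since [fine] sends infinity
to 0. *)
Lemma sqr_L2norm f : L2norm Omega f ^+ 2 = integral_on Omega (fun x => f x * f x).
Proof.
rewrite /L2norm /integral_on Rintegral_mkcond /Rintegral.
have <- : (\int[mu]_x `|(EFin \o f \_ Omega) x| `^ 2 =
    \int[mu]_x (((fun x => f x * f x) \_ Omega) x)%:E)%E.
  apply: eq_integral => x _ /=; rewrite powR_mulrn// real_normK ?num_real//.
  by rewrite !patchE; case: ifPn => _; rewrite expr2 ?mulr0.
rewrite -powR_Lnorm//; have := Lnorm_ge0 mu 2%:E (EFin \o f \_ Omega).
(* the three cases are a finite norm, an infinite one, and an impossible one *)
case: ('N[mu]_2%:E[_])%E => //= r.
- by rewrite lee_fin => r0; rewrite powR_mulrn.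
- by rewrite /poweR/= expr0n pnatr_eq0.
Qed.

Lemma L2P f : L2 Omega f <-> measurable_fun setT (f \_ Omega) /\
  mu.-integrable setT (EFin \o (fun x => (f \_ Omega) x ^+ 2)).
Proof.
split=> [Lf|[mf iff]].
  by split; [move: Lf => /andP[/[!inE]]|exact: Lfun2_integrable_sqr].
apply/andP; split; rewrite inE//= /finite_norm unlock /Lnorm.
apply: poweR_lty; move/integrableP : iff => [_]; apply: le_lt_trans.
rewrite le_eqVlt; apply/orP; left; apply/eqP; apply: eq_integral => x _ /=.
by rewrite powR_mulrn// real_normK ?num_real// ger0_norm ?sqr_ge0.
Qed.

Lemma L2_measurable f : L2 Omega f -> measurable_fun Omega f.
Proof. by move=> /L2P[/(measurable_restrictT _ mO)]. Qed.

Lemma L2D f g : L2 Omega f -> L2 Omega g -> L2 Omega (fun x => f x + g x).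
Proof.
rewrite /L2 (_ : (fun x => f x + g x) \_ Omega = (f \_ Omega) + (g \_ Omega)); last first.
  apply/funext => x; rewrite [RHS](_ : _ = (f \_ Omega) x + (g \_ Omega) x)//.
  by rewrite !patchE; case: ifPn; rewrite ?addr0.
by move=> Lf Lg; have [_] := Lfun_addr_closed mu (lee1n 2); exact.
Qed.

Lemma L2Z c f : L2 Omega f -> L2 Omega (fun x => c * f x).
Proof.
rewrite /L2 (_ : (fun x => c * f x) \_ Omega = c \o* (f \_ Omega)); last first.
  by apply/funext => x /=; rewrite !patchE; case: ifPn => //; rewrite ?mul0r// mulrC.
by move=> Lf; apply: Lfun_scale => //; rewrite ler1n.
Qed.

Lemma L2_0 : L2 Omega (fun=> 0).
Proof.
apply/L2P; rewrite (_ : (fun=> 0) \_ Omega = cst 0); last first.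
  by apply/funext => x; rewrite patchE; case: ifPn.
split; first exact: measurable_cst.
rewrite (_ : EFin \o _ = cst 0%E); first exact: integrable0.
by apply/funext => x /=; rewrite expr0n.
Qed.

Lemma L2B f g : L2 Omega f -> L2 Omega g -> L2 Omega (fun x => f x - g x).
Proof.
move=> Lf Lg; rewrite (_ : (fun _ => _) = (fun x => f x + - 1 * g x)).
  by apply: L2D => //; exact: L2Z.
by apply/funext => x; rewrite mulN1r.
Qed.

Lemma L2_sum (I : Type) (s : seq I) (F : I -> 'rV[R]_d -> R) :
  (forall i, L2 Omega (F i)) -> L2 Omega (fun x => \sum_(i <- s) F i x).
Proof.
move=> LF; elim: s => [|i s ih].
  by under eq_fun do rewrite big_nil; exact: L2_0.
by under eq_fun do rewrite big_cons; exact: L2D.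
Qed.

Lemma L2_integrableM f g : L2 Omega f -> L2 Omega g ->
  mu.-integrable Omega (EFin \o (fun x => f x * g x)).
Proof.
move=> Lf Lg; apply/(integrable_mkcond _ mO).
have /Lfun1_integrable := Lfun2_mul_Lfun1 Lf Lg.
rewrite (_ : (EFin \o (f \_ Omega \* g \_ Omega)%R)%E =
  (EFin \o (fun x => f x * g x)) \_ Omega)//.
by apply/funext => x /=; rewrite !patchE; case: ifPn => //=; rewrite mulr0.
Qed.

Lemma ae_eq_integral_on f g : measurable_fun Omega f -> measurable_fun Omega g ->
  ae_on Omega (fun x => f x = g x) -> integral_on Omega f = integral_on Omega g.
Proof.
move=> mf mg fg; rewrite /integral_on /Rintegral; congr fine.
apply: ae_eq_integral => //; [exact/measurable_EFinP|exact/measurable_EFinP|].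
by apply: ae_onS fg => x ->.
Qed.

Lemma integral_onD f g : mu.-integrable Omega (EFin \o f) ->
  mu.-integrable Omega (EFin \o g) ->
  integral_on Omega (fun x => f x + g x) =
  integral_on Omega f + integral_on Omega g.
Proof. by move=> ? ?; rewrite /integral_on RintegralD. Qed.

Lemma integral_onB f g : mu.-integrable Omega (EFin \o f) ->
  mu.-integrable Omega (EFin \o g) ->
  integral_on Omega (fun x => f x - g x) =
  integral_on Omega f - integral_on Omega g.
Proof. by move=> ? ?; rewrite /integral_on RintegralB. Qed.

Lemma integral_onZ c f : mu.-integrable Omega (EFin \o f) ->
  integral_on Omega (fun x => c * f x) = c * integral_on Omega f.
Proof. by move=> ?; rewrite /integral_on RintegralZl. Qed.

Definition L2dot f g := integral_on Omega (fun x => f x * g x).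

Lemma L2dotC f g : L2dot f g = L2dot g f.
Proof. by rewrite /L2dot; under eq_fun do rewrite mulrC. Qed.

Lemma L2dot_ael f f' g : L2 Omega f -> L2 Omega f' -> L2 Omega g ->
  ae_on Omega (fun x => f x = f' x) -> L2dot f g = L2dot f' g.
Proof.
move=> Lf Lf' Lg ff'; apply: ae_eq_integral_on.
- by apply: measurable_funM; exact: L2_measurable.
- by apply: measurable_funM; exact: L2_measurable.
- by apply: ae_onS ff' => x ->.
Qed.

Lemma L2dot_linearl c f f' g : L2 Omega f -> L2 Omega f' -> L2 Omega g ->
  L2dot (fun x => c * f x + f' x) g = c * L2dot f g + L2dot f' g.
Proof.
move=> Lf Lf' Lg; rewrite /L2dot -integral_onZ; last exact: L2_integrableM.
rewrite -integral_onD.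
- by congr integral_on; apply/funext => x; rewrite mulrDl mulrA.
- have := L2_integrableM (L2Z c Lf) Lg.
  by rewrite (_ : (fun x => c * f x * g x) = (fun x => c * (f x * g x)))//;
    apply/funext => x; rewrite mulrA.
- exact: L2_integrableM.
Qed.

Lemma L2dot_linearr c f g g' : L2 Omega f -> L2 Omega g -> L2 Omega g' ->
  L2dot f (fun x => c * g x + g' x) = c * L2dot f g + L2dot f g'.
Proof. by move=> Lf Lg Lg'; rewrite L2dotC L2dot_linearl// !(L2dotC _ f). Qed.

Context (m n : nat).
Implicit Types F G H : 'rV[R]_d -> 'M[R]_(m, n).

Definition L2dotmx F G := integral_on Omega (fun x => dot (F x) (G x)).

Lemma dotC (A B : 'M[R]_(m, n)) : dot A B = dot B A.
Proof. by apply: eq_bigr => i _; apply: eq_bigr => j _; rewrite mulrC. Qed.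

Lemma dot_ge0 (A : 'M[R]_(m, n)) : 0 <= dot A A.
Proof. by apply: sumr_ge0 => i _; apply: sumr_ge0 => j _; rewrite -expr2 sqr_ge0. Qed.

Lemma dot_linearl c (A A' B : 'M[R]_(m, n)) :
  dot (c *: A + A') B = c * dot A B + dot A' B.
Proof.
rewrite /dot mulr_sumr -big_split; apply: eq_bigr => i _ /=.
rewrite mulr_sumr -big_split; apply: eq_bigr => j _ /=.
by rewrite !mxE mulrDl mulrA.
Qed.

Lemma L2mx_integrable_dot F G : L2mx Omega F -> L2mx Omega G ->
  mu.-integrable Omega (EFin \o (fun x => dot (F x) (G x))).
Proof.
move=> LF LG.
rewrite (_ : EFin \o _ = (fun x => \sum_i \sum_j ((F x i j * G x i j)%:E))%E); last first.
  by apply/funext => x /=; rewrite /dot -sumEFin; apply: eq_bigr => i _; rewrite -sumEFin.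
apply: (@integrable_sum _ _ _ mu Omega mO _ _ _
  (fun i x => \sum_j ((F x i j * G x i j)%:E))%E) => // i _.
apply: (@integrable_sum _ _ _ mu Omega mO _ _ _
  (fun j x => ((F x i j * G x i j)%:E))%E) => // j _.
exact: L2_integrableM.
Qed.

Lemma L2mxD F G : L2mx Omega F -> L2mx Omega G -> L2mx Omega (fun x => F x + G x).
Proof. by move=> LF LG i j; under eq_fun do rewrite mxE; exact: L2D. Qed.

Lemma L2mxZ c F : L2mx Omega F -> L2mx Omega (fun x => c *: F x).
Proof. by move=> LF i j; under eq_fun do rewrite mxE; exact: L2Z. Qed.

Lemma L2mxB F G : L2mx Omega F -> L2mx Omega G -> L2mx Omega (F \- G).
Proof. by move=> LF LG i j; under eq_fun do rewrite !mxE; exact: L2B. Qed.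

Lemma L2dotmxC F G : L2dotmx F G = L2dotmx G F.
Proof. by rewrite /L2dotmx; under eq_fun do rewrite dotC. Qed.

Lemma L2dotmx_linearl c F F' G : L2mx Omega F -> L2mx Omega F' -> L2mx Omega G ->
  L2dotmx (fun x => c *: F x + F' x) G = c * L2dotmx F G + L2dotmx F' G.
Proof.
move=> LF LF' LG; rewrite /L2dotmx -integral_onZ; last exact: L2mx_integrable_dot.
rewrite -integral_onD.
- by congr integral_on; apply/funext => x; rewrite dot_linearl.
- have := L2mx_integrable_dot (L2mxZ c LF) LG.
  rewrite (_ : (fun x => dot (c *: F x) (G x)) = (fun x => c * dot (F x) (G x)))//.
  apply/funext => x; rewrite -[c *: F x]addr0 dot_linearl.
  by rewrite [X in _ + X](_ : dot 0 (G x) = 0) ?addr0// /dot big1// => i _;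
    rewrite big1// => j _; rewrite mxE mul0r.
- exact: L2mx_integrable_dot.
Qed.

Lemma L2dotmx_linearr c F G G' : L2mx Omega F -> L2mx Omega G -> L2mx Omega G' ->
  L2dotmx F (fun x => c *: G x + G' x) = c * L2dotmx F G + L2dotmx F G'.
Proof. by move=> ? ? ?; rewrite L2dotmxC L2dotmx_linearl// !(L2dotmxC _ F). Qed.

Lemma L2dotmxBl F F' G : L2mx Omega F -> L2mx Omega F' -> L2mx Omega G ->
  L2dotmx (F \- F') G = L2dotmx F G - L2dotmx F' G.
Proof.
move=> LF LF' LG.
rewrite (_ : F \- F' = (fun x => (- 1) *: F' x + F x)); last first.
  by apply/funext => x /=; rewrite scaleN1r addrC.
by rewrite L2dotmx_linearl// mulN1r addrC.
Qed.

Lemma L2dotmxBr F G G' : L2mx Omega F -> L2mx Omega G -> L2mx Omega G' ->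
  L2dotmx F (G \- G') = L2dotmx F G - L2dotmx F G'.
Proof. by move=> ? ? ?; rewrite L2dotmxC L2dotmxBl// !(L2dotmxC _ F). Qed.

Lemma L2dotmx_ael F F' G : L2mx Omega F -> L2mx Omega F' -> L2mx Omega G ->
  ae_on Omega (fun x => F x = F' x) -> L2dotmx F G = L2dotmx F' G.
Proof.
move=> LF LF' LG FF'.
have md H H' : L2mx Omega H -> L2mx Omega H' ->
    measurable_fun Omega (fun x => dot (H x) (H' x)).
  by move=> LH LH'; apply/measurable_EFinP; apply: (measurable_int mu); exact: L2mx_integrable_dot.
apply: ae_eq_integral_on; [exact: md|exact: md|].
by apply: ae_onS FF' => x ->.
Qed.

Lemma sqr_L2normmx F : L2normmx Omega F ^+ 2 = L2dotmx F F.
Proof.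
rewrite /L2normmx sqr_L2norm; congr integral_on; apply/funext => x.
by rewrite -expr2 sqr_sqrtr// dot_ge0.
Qed.

Lemma L2normmx_ge0 F : 0 <= L2normmx Omega F.
Proof. exact: L2norm_ge0. Qed.

Lemma L2dotmx_ge0 F : 0 <= L2dotmx F F.
Proof. by rewrite -sqr_L2normmx sqr_ge0. Qed.

Lemma cauchy_schwarz F G : L2mx Omega F -> L2mx Omega G ->
  `|L2dotmx F G| <= L2normmx Omega F * L2normmx Omega G.
Proof.
move=> LF LG.
rewrite -ler_sqr ?nnegrE ?mulr_ge0 ?L2normmx_ge0//.
rewrite real_normK ?num_real// exprMn !sqr_L2normmx.
have pos t : 0 <= L2dotmx F F + 2 * t * L2dotmx F G + t ^+ 2 * L2dotmx G G.
  have := L2dotmx_ge0 (fun x => t *: G x + F x).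
  have LtGF : L2mx Omega (fun x => t *: G x + F x) by apply: L2mxD => //; exact: L2mxZ.
  rewrite L2dotmx_linearl// !L2dotmx_linearr// (L2dotmxC G F); congr (_ <= _); ring.
(* when [G] vanishes almost everywhere the quadratic polynomial [pos] is affine *)
have [c0|c0] := eqVneq (L2dotmx G G) 0.
  have [->|b0] := eqVneq (L2dotmx F G) 0; first by rewrite expr0n mulr_ge0 ?L2dotmx_ge0.
  (* at this point the affine function takes the value -1 *)
  have := pos (- (L2dotmx F F + 1) / (2 * L2dotmx F G)).
  rewrite c0 mulr0 addr0 (_ : _ + _ = -1); last by field; rewrite b0.
  by rewrite ler0N1.
have cp : 0 < L2dotmx G G by rewrite lt0r c0 L2dotmx_ge0.
(* the minimum of the quadratic polynomial *)
have := pos (- L2dotmx F G / L2dotmx G G).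
rewrite (_ : _ + _ + _ = L2dotmx F F - L2dotmx F G ^+ 2 / L2dotmx G G); last by field.
by rewrite subr_ge0 ler_pdivrMr.
Qed.

End L2_theory.

(** * Weak derivatives and the double divergence *)

Section tensor_theory.
Context (R : realType) (d : nat).
Implicit Types (P : tensor R d) (X Y : 'M[R]_d).

Lemma dot_ttr P X Y : dot (tapp (ttr P) X) Y = dot X (tapp P Y).
Proof.
rewrite /dot /tapp /ttr.
transitivity (\sum_i \sum_j \sum_k \sum_l P k l i j * X k l * Y i j).
  apply: eq_bigr => i _; apply: eq_bigr => j _; rewrite mxE mulr_suml.
  by apply: eq_bigr => k _; rewrite mulr_suml.
transitivity (\sum_k \sum_l \sum_i \sum_j P k l i j * X k l * Y i j); last first.
  apply: eq_bigr => k _; apply: eq_bigr => l _; rewrite mxE mulr_sumr.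
  apply: eq_bigr => i _; rewrite mulr_sumr; apply: eq_bigr => j _.
  by rewrite mulrCA mulrA.
under eq_bigr do rewrite exchange_big.
rewrite exchange_big; apply: eq_bigr => k _ /=.
by under eq_bigr do rewrite exchange_big; rewrite exchange_big.
Qed.

Lemma L2mx_tapp (Omega : set 'rV[R]_d) P (F : 'rV[R]_d -> 'M[R]_d) :
  L2mx Omega F -> L2mx Omega (fun x => tapp P (F x)).
Proof.
move=> LF i j; under eq_fun do rewrite mxE.
by apply: L2_sum => k; apply: L2_sum => l; exact: L2Z.
Qed.

End tensor_theory.

Section weak_derivatives.
Context (R : realType) (d : nat) (Omega : set 'rV[R]_d).
Hypothesis (d0 : (0 < d)%N) (oO : open Omega) (bO : bounded_set Omega).
Local Notation mu := (lebesgue_rV R d).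
Implicit Types (f g v phi : 'rV[R]_d -> R).

Let mO : measurable Omega := open_measurable_rV oO.

Lemma test_function_restrict phi : test_function Omega phi -> phi \_ Omega = phi.
Proof.
move=> tphi; apply/funext => x; rewrite patchE; case: ifPn => // /negP xO.
rewrite (test_function_outside tphi)// => Ox; apply: xO; exact/mem_set.
Qed.

Lemma test_function_L2 phi : test_function Omega phi -> L2 Omega phi.
Proof.
move=> tphi; apply/L2P; rewrite test_function_restrict//.
have cphi := test_function_continuous tphi.
split; first exact: continuous_measurable_rV.
apply: continuous_bounded_support_integrable.
- move=> x; rewrite /continuous_at; under eq_fun do rewrite expr2.
  by apply: continuousM; exact: cphi.
- have [M phiM] := test_function_bounded_support tphi.
  by exists M => x; rewrite expf_eq0/= => /phiM.
Qed.

(** A bounded set has finite measure, so the constant 1 is square integrable. *)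
Lemma L2_integrable f : L2 Omega f -> mu.-integrable setT (EFin \o (f \_ Omega)).
Proof.
move=> Lf; have L1 : L2 Omega (fun=> 1).
  apply/L2P; split; first by apply/(measurable_restrictT _ mO); exact: measurable_cst.
  rewrite (_ : EFin \o _ = (EFin \o cst 1) \_ Omega); last first.
    by apply/funext => x /=; rewrite !patchE; case: ifPn; rewrite ?expr1n// expr0n.
  apply: (integrable_mkcond (EFin \o cst 1) mO).1.
  apply: measurable_bounded_integrable => //.
  - exact: bounded_lebesgue_lty.
  - exact: bounded_cst.
have := L2_integrableM mO Lf L1.
under [X in integrable _ _ X]eq_fun do rewrite /= mulr1.
move=> /(integrable_mkcond _ mO); congr (integrable _ _ _).
by apply/funext => x /=; rewrite !patchE; case: ifPn.
Qed.

(** The uniqueness principle behind all representatives chosen in the sequel. *)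
Lemma L2_test_ae_eq f g : L2 Omega f -> L2 Omega g ->
  (forall phi, test_function Omega phi ->
    integral_on Omega (fun x => f x * phi x) = integral_on Omega (fun x => g x * phi x)) ->
  ae_on Omega (fun x => f x = g x).
Proof.
move=> Lf Lg fg; pose w := (fun x => f x - g x) \_ Omega.
have Lw := L2B Lf Lg.
suff : {ae mu, forall x, Omega x -> w x = 0}.
  apply: filterS => x wx Ox; have := wx Ox.
  by rewrite /w patchE mem_set// => /subr0_eq.
apply: fundamental_lemma => //; first exact: L2_integrable.
move=> phi tphi; have Lphi := test_function_L2 tphi.
have E : EFin \o (fun x => w x * phi x) = (EFin \o (fun x => (f x - g x) * phi x)) \_ Omega.
  by apply/funext => x /=; rewrite /w !patchE; case: ifPn => //; rewrite mul0r.
have iwphi := L2_integrableM mO Lw Lphi.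
have : integral_on Omega (fun x => (f x - g x) * phi x) = 0.
  rewrite (_ : (fun _ => _) = (fun x => f x * phi x - g x * phi x)); last first.
    by apply/funext => x; rewrite mulrBl.
  rewrite integral_onB//; [|exact: L2_integrableM..].
  by rewrite fg// subrr.
rewrite /integral_on /Rintegral => /eqP; rewrite fine_eq0.
  by move=> /eqP; rewrite integral_mkcond -E.
exact: integrable_fin_num.
Qed.

Lemma weak_partial_unique i v g g' : is_weak_partial Omega i v g ->
  is_weak_partial Omega i v g' -> ae_on Omega (fun x => g x = g' x).
Proof.
move=> [Lg vg] [Lg' vg']; apply: L2_test_ae_eq => // phi tphi.
by apply: oppr_inj; rewrite -vg// -vg'.
Qed.

Lemma weak_partialP i v g : is_weak_partial Omega i v g ->
  is_weak_partial Omega i v (weak_partial Omega i v).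
Proof. by move=> vg; apply: (@getPex _ [set g | is_weak_partial Omega i v g]); exists g. Qed.

Lemma weak_partial_ae i v g : is_weak_partial Omega i v g ->
  ae_on Omega (fun x => weak_partial Omega i v x = g x).
Proof. by move=> vg; exact: weak_partial_unique (weak_partialP vg) vg. Qed.

(** The function [v] is any representative of the class of [phi]. This freedom is
used for second derivatives: the first weak derivative is only known almost
everywhere. *)
Lemma is_weak_partial_test i v phi : test_function Omega phi -> L2 Omega v ->
  ae_on Omega (fun x => v x = phi x) -> is_weak_partial Omega i v (partial i phi).
Proof.
move=> tphi Lv vphi; have tpphi := test_function_partial i tphi.
split; first exact: test_function_L2.
move=> psi tpsi; have tppsi := test_function_partial i tpsi.
have Lphi := test_function_L2 tphi; have Lpsi := test_function_L2 tpsi.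
have Lpphi := test_function_L2 tpphi; have Lppsi := test_function_L2 tppsi.
have := L2dot_ael mO Lv Lphi Lppsi vphi; rewrite /L2dot => ->.
apply/eqP; rewrite -addr_eq0 addrC -integral_onD; [|exact: mO|exact: L2_integrableM..].
rewrite /integral_on Rintegral_mkcond /Rintegral.
rewrite (_ : (fun _ => _) \_ Omega = (fun x => partial i phi x * psi x + phi x * partial i psi x)).
  by rewrite (integral_partial_test i tphi tpsi).
apply/funext => x; rewrite patchE; case: ifPn => // /negP xO.
have Ox : ~ Omega x by move=> Ox; apply: xO; exact/mem_set.
by rewrite (test_function_outside tphi)// (test_function_outside tpsi)// mulr0 mul0r addr0.
Qed.

Lemma test_function_weak_partial i phi : test_function Omega phi ->
  is_weak_partial Omega i phi (partial i phi).
Proof.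
move=> tphi; apply: is_weak_partial_test => //; first exact: test_function_L2.
by apply: aeW => x Ox.
Qed.

Lemma test_function_weak_partial2 i j phi : test_function Omega phi ->
  is_weak_partial Omega i (weak_partial Omega j phi) (partial i (partial j phi)).
Proof.
move=> tphi; have wj := test_function_weak_partial j tphi.
apply: is_weak_partial_test; first exact: test_function_partial.
- by have [] := weak_partialP wj.
- exact: weak_partial_ae.
Qed.

Lemma ae_on_forall (I : finType) (P : I -> 'rV[R]_d -> Prop) :
  (forall i, ae_on Omega (P i)) -> ae_on Omega (fun x => forall i, P i x).
Proof.
move=> aeP; have : {ae mu, forall x, forall i, Omega x -> P i x}.
  by apply: filter_forall => i; exact: aeP.
by apply: filterS => x Px Ox i; exact: Px.
Qed.

Lemma grad_test_ae phi : test_function Omega phi ->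
  ae_on Omega (fun x => grad Omega phi x = \row_i partial i phi x).
Proof.
move=> tphi.
have : ae_on Omega (fun x => forall i, weak_partial Omega i phi x = partial i phi x).
  by apply: ae_on_forall => i; apply: weak_partial_ae; exact: test_function_weak_partial.
by apply: ae_onS => x h; apply/rowP => i; rewrite !mxE.
Qed.

Lemma hess_test_ae phi : test_function Omega phi ->
  ae_on Omega (fun x => hess Omega phi x = partial2 phi x).
Proof.
move=> tphi.
have : ae_on Omega (fun x => forall i j,
    weak_partial Omega i (weak_partial Omega j phi) x = partial i (partial j phi) x).
  apply: ae_on_forall => i; apply: ae_on_forall => j.
  by apply: weak_partial_ae; exact: test_function_weak_partial2.
by apply: ae_onS => x h; apply/matrixP => i j; rewrite !mxE.
Qed.

Lemma H2_hess_L2 v : H2 Omega v -> L2mx Omega (hess Omega v).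
Proof.
move=> [_ Hv] i j; under eq_fun do rewrite mxE.
by have [_ /(_ i)[g /weak_partialP[]]] := Hv j.
Qed.

Lemma H2_grad_L2 v : H2 Omega v -> L2mx Omega (grad Omega v).
Proof.
move=> [[_ Hv] _] i j; under eq_fun do rewrite mxE.
by have [g /weak_partialP[]] := Hv j.
Qed.

Lemma test_function_H2 phi : test_function Omega phi -> H2 Omega phi.
Proof.
move=> tphi; split; first split.
- exact: test_function_L2.
- by move=> i; exists (partial i phi); exact: test_function_weak_partial.
- move=> j; split; first by have [] := weak_partialP (test_function_weak_partial j tphi).
  by move=> i; exists (partial i (partial j phi)); exact: test_function_weak_partial2.
Qed.

Lemma L2normmx_eq0 m n (F : 'rV[R]_d -> 'M[R]_(m, n)) : L2mx Omega F ->
  ae_on Omega (fun x => F x = 0) -> L2normmx Omega F = 0.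
Proof.
move=> LF F0; apply/eqP; rewrite -sqrf_eq0 sqr_L2normmx.
rewrite (L2dotmx_ael (F' := fun=> 0) mO LF _ LF F0); last first.
  by move=> i j; under eq_fun do rewrite mxE; exact: L2_0.
have L0 : L2mx Omega (fun=> 0 : 'M[R]_(m, n)).
  by move=> i j; under eq_fun do rewrite mxE; exact: L2_0.
by rewrite (_ : (fun=> 0) = F \- F) ?L2dotmxBl ?subrr//; apply/funext => x /=; rewrite subrr.
Qed.

(** The weak derivatives of 0 are arbitrary representatives of 0, hence the
detour through almost everywhere equality. *)
Lemma H2norm0 : H2norm Omega (cst 0) = 0.
Proof.
have t0 := test_function0 Omega; have H0 := test_function_H2 t0.
have p0 i : partial i (cst 0 : 'rV[R]_d -> R) = cst 0.
  by apply/funext => x; exact: derive_cst.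
rewrite /H2norm L2normmx_eq0; last 2 first.
- exact: H2_grad_L2.
- by apply: ae_onS (grad_test_ae t0) => x ->; apply/rowP => i; rewrite !mxE p0.
rewrite L2normmx_eq0; last 2 first.
- exact: H2_hess_L2.
- by apply: ae_onS (hess_test_ae t0) => x ->; apply/matrixP => i j; rewrite !mxE !p0.
rewrite sqr_L2norm (_ : (fun _ => _) = cst 0); last by apply/funext => x; rewrite mulr0.
by rewrite /integral_on /Rintegral integral0/= expr0n/= !addr0 sqrtr0.
Qed.

Lemma test_function_H20 phi : test_function Omega phi -> H20 Omega phi.
Proof.
move=> tphi; split; first exact: test_function_H2.
move=> e e0; exists phi => //.
rewrite (_ : phi \- phi = cst 0) ?H2norm0//.
by apply/funext => x /=; rewrite subrr.
Qed.

Lemma divdiv_ae xi f : is_divdiv Omega xi f ->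
  L2 Omega (divdiv Omega xi) /\ ae_on Omega (fun x => divdiv Omega xi x = f x).
Proof.
move=> xif; have [Lh xih] : is_divdiv Omega xi (divdiv Omega xi).
  by apply: (@getPex _ [set h | is_divdiv Omega xi h]); exists f.
have [Lf xif'] := xif.
by split => //; apply: L2_test_ae_eq => // phi tphi; rewrite -xih// -xif'.
Qed.

(** Test functions are admissible in the weak equation, and their weak Hessian
agrees almost everywhere with the classical one; transposing [B] moves it back to
the other factor. *)
Lemma weak_solution_divdiv (B : tensor R d) u f : L2 Omega f -> H20 Omega u ->
  (forall v, H20 Omega v ->
    form_a Omega B u v = integral_on Omega (fun x => f x * v x)) ->
  is_divdiv Omega (fun x => tapp (ttr B) (tapp B (hess Omega u x))) f.
Proof.
move=> Lf [H2u _] uf; split => // phi tphi.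
rewrite -uf; last exact: test_function_H20.
have LBu : L2mx Omega (hessB Omega B u) by apply: L2mx_tapp; exact: H2_hess_L2.
have H2phi := test_function_H2 tphi.
rewrite /form_a; under eq_fun do rewrite dot_ttr.
have Lp : L2mx Omega (partial2 phi).
  move=> i j; under eq_fun do rewrite mxE.
  by apply: test_function_L2; do 2 apply: test_function_partial.
have LBphi : L2mx Omega (hessB Omega B phi).
  by apply: L2mx_tapp; exact: H2_hess_L2.
have LBp : L2mx Omega (fun x => tapp B (partial2 phi x)) by exact: L2mx_tapp.
have h : ae_on Omega (fun x => tapp B (partial2 phi x) = hessB Omega B phi x).
  by apply: ae_onS (hess_test_ae tphi) => x; rewrite /hessB => ->.
have E := L2dotmx_ael mO LBp LBphi LBu h.
transitivity (L2dotmx Omega (fun x => tapp B (partial2 phi x)) (hessB Omega B u)).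
  by congr integral_on; apply/funext => x; rewrite dotC.
by apply: etrans E _; rewrite L2dotmxC.
Qed.

End weak_derivatives.

(** * Hessian discretisations *)

(** The endomorphism mapping [u] to the sum of the [b u e_i *: e_i], for a basis
[e], is injective by nondegeneracy, hence invertible in finite dimension. *)
Lemma riesz_bilinear (K : fieldType) (X : vectType K) (b : X -> X -> K)
    (l : X -> K) :
  (forall c u u' v, b (c *: u + u') v = c * b u v + b u' v) ->
  (forall c u v v', b u (c *: v + v') = c * b u v + b u v') ->
  (forall u, (forall v, b u v = 0) -> u = 0) ->
  (forall c v v', l (c *: v + v') = c * l v + l v') ->
  exists z, forall v, b z v = l v.
Proof.
move=> bl br b0 ll; pose e := vbasis (fullv : {vspace X}).
have be : basis_of fullv e by exact: vbasisP.
have ext (k k' : X -> K) : (forall c v v', k (c *: v + v') = c * k v + k v') ->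
    (forall c v v', k' (c *: v + v') = c * k' v + k' v') ->
    (forall i : 'I_(\dim (fullv : {vspace X})), k e`_i = k' e`_i) -> forall v, k v = k' v.
  move=> lk lk' kk' v; rewrite (coord_vbasis (memvf v)).
  have linE (h : X -> K) a : (forall c v v', h (c *: v + v') = c * h v + h v') ->
      h (\sum_(i < \dim (fullv : {vspace X})) a i *: e`_i) = \sum_i a i * h e`_i.
    move=> lh; have h0 : h 0 = 0.
      by have := lh (-1) 0 0; rewrite scaler0 addr0 mulN1r addNr.
    have hD x y : h (x + y) = h x + h y by rewrite -[x]scale1r lh mul1r scale1r.
    rewrite (big_morph h hD h0); apply: eq_bigr => i _.
    by rewrite -[X in h X]addr0 lh h0 addr0.
  by rewrite !linE//; apply: eq_bigr => i _; rewrite kk'.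
pose F u := \sum_(i < \dim (fullv : {vspace X})) b u e`_i *: e`_i.
have linF : linear F.
  move=> c u u'; rewrite /F scaler_sumr -big_split; apply: eq_bigr => i _ /=.
  by rewrite bl scalerDl scalerA.
pose FL : {linear X -> X} := HB.pack F (GRing.isLinear.Build K X X *:%R F linF).
have coordF (a : 'I_(\dim (fullv : {vspace X})) -> K) i :
    coord e i (\sum_j a j *: e`_j) = a i.
  by rewrite coord_sum_free//; exact: basis_free be.
have kF : lker (linfun FL) == 0%VS.
  apply/eqP/vspaceP => u; rewrite memv_ker memv0 lfunE/=.
  apply/eqP/eqP => [Fu|->]; last exact: (linear0 FL).
  apply: b0; apply: ext => //.
  - by move=> c v v'; rewrite mulr0 addr0.
  - move=> i; rewrite -(coordF (fun i => b u e`_i) i) -/(F u).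
    by rewrite [F u]Fu linear0.
exists ((linfun FL)^-1%VF (\sum_(i < \dim (fullv : {vspace X})) l e`_i *: e`_i)).
apply: ext => // i.
set z := (linfun FL)^-1%VF _; rewrite -(coordF (fun i => b z e`_i) i) -/(F z).
have -> : F z = linfun FL z by rewrite lfunE.
by rewrite lker0_lfunVK// coordF.
Qed.

Section discretisation_theory.
Context (R : realType) (d : nat) (Omega : set 'rV[R]_d) (B : tensor R d).
Hypothesis mO : measurable Omega.
Variable D : hessian_discretisation Omega.
Implicit Types (v w : D) (F : 'rV[R]_d -> 'M[R]_d) (f : 'rV[R]_d -> R).

Definition energy w := L2normmx Omega (hd_hess w).

Lemma energy_ge0 w : 0 <= energy w.
Proof. exact: L2normmx_ge0. Qed.

Lemma sqr_energy w : energy w ^+ 2 = form_aD w w.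
Proof. exact: sqr_L2normmx. Qed.

Lemma energy_eq0 w : energy w = 0 -> w = 0.
Proof. by have [_ _] := @hd_hess_norm _ _ _ D; exact. Qed.

Lemma L2dotmx_hess_linear F c v w : L2mx Omega F ->
  L2dotmx Omega F (hd_hess (c *: v + w)) =
  c * L2dotmx Omega F (hd_hess v) + L2dotmx Omega F (hd_hess w).
Proof.
move=> LF; have Lv := hd_hess_L2 v; have Lw := hd_hess_L2 w.
rewrite -L2dotmx_linearr// L2dotmxC [RHS]L2dotmxC; apply: (L2dotmx_ael mO) => //.
- exact: hd_hess_L2.
- by apply: L2mxD => //; exact: L2mxZ.
- exact: hd_hess_linear.
Qed.

Lemma L2dot_Pi_linear f c v w : L2 Omega f ->
  L2dot Omega f (hd_Pi (c *: v + w)) = c * L2dot Omega f (hd_Pi v) + L2dot Omega f (hd_Pi w).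
Proof.
move=> Lf; have Lv := hd_Pi_L2 v; have Lw := hd_Pi_L2 w.
rewrite -L2dot_linearr// L2dotC [RHS]L2dotC; apply: (L2dot_ael mO) => //.
- exact: hd_Pi_L2.
- by apply: L2D => //; exact: L2Z.
- exact: hd_Pi_linear.
Qed.

Lemma form_aD_linearr c u v w :
  form_aD u (c *: v + w) = c * form_aD u v + form_aD u w.
Proof. by apply: L2dotmx_hess_linear; exact: hd_hess_L2. Qed.

Lemma form_aDC v w : form_aD v w = form_aD w v.
Proof. exact: L2dotmxC. Qed.

Lemma discrete_riesz (l : D -> R) :
  (forall c v w, l (c *: v + w) = c * l v + l w) ->
  exists z : D, forall w, form_aD z w = l w.
Proof.
move=> ll; apply: riesz_bilinear => //.
- by move=> c u u' v; rewrite form_aDC form_aD_linearr !(form_aDC v).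
- exact: form_aD_linearr.
- move=> u u0; apply: energy_eq0; apply/eqP.
  by rewrite -sqrf_eq0 sqr_energy u0.
Qed.

Lemma W_D_ge0 xi : 0 <= W_D B D xi.
Proof.
rewrite /W_D; set S := (X in sup X).
have [hs|hs] := pselect (has_sup S); last by rewrite sup_out.
have [[r rS] hu] := hs; apply: (@le_trans _ _ r); last exact: ub_le_sup.
by case: rS => w _ <-; rewrite divr_ge0// L2normmx_ge0.
Qed.

Lemma S_D_ge0 phi : 0 <= S_D B D phi.
Proof.
apply: lb_le_inf.
  by eexists; exists (0 : D).
by move=> _ [w _ <-]; rewrite !addr_ge0// ?L2normmx_ge0// L2norm_ge0.
Qed.

Lemma WS_D_ge_W_D phi : W_D B D (hess Omega phi) <= WS_D B D phi.
Proof. by rewrite lerDl S_D_ge0. Qed.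

(** The quotients in the supremum defining [W_D] are bounded by the energy of the
Riesz representative of the functional, by the Cauchy-Schwarz inequality. So the
supremum is an upper bound. *)
Lemma limit_defect_le_of_linear xi :
  (forall c v w, limit_defect B xi (c *: v + w) =
    c * limit_defect B xi v + limit_defect B xi w) ->
  forall w, `|limit_defect B xi w| <= W_D B D xi * energy w.
Proof.
move=> ll w; have [z zl] := discrete_riesz ll.
have zb v : `|limit_defect B xi v| <= energy z * energy v.
  by rewrite -zl; apply: (cauchy_schwarz mO); exact: hd_hess_L2.
have [w0|w0] := eqVneq (energy w) 0.
  by have := zb w; rewrite w0 !mulr0.
have ep v : v != 0 -> 0 < energy v.
  move=> v0; rewrite lt0r energy_ge0 andbT.
  by apply: contraNN v0 => /eqP /energy_eq0 ->.
have wn0 : w != 0.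
  apply: contraNN w0 => /eqP w0; rewrite -sqrf_eq0 sqr_energy w0.
  have := form_aD_linearr (-1) (0 : D) 0 0.
  by rewrite scaler0 addr0 mulN1r addNr => ->.
rewrite -ler_pdivrMr; last exact: ep.
apply: ub_le_sup; last by exists w.
exists (energy z) => _ [v v0 <-].
by rewrite ler_pdivrMr//; exact: ep.
Qed.

Lemma limit_defectE xi h : L2mx Omega xi -> L2 Omega h ->
  L2 Omega (divdiv Omega (fun y => tapp (ttr B) (tapp B (xi y)))) ->
  ae_on Omega (fun x => divdiv Omega (fun y => tapp (ttr B) (tapp B (xi y))) x = h x) ->
  forall w, limit_defect B xi w =
    L2dot Omega h (hd_Pi w) - L2dotmx Omega (fun x => tapp B (xi x)) (hd_hess w).
Proof.
move=> Lxi Lh Ldd ddh w; rewrite /limit_defect integral_onB//.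
- congr (_ - _); apply: (L2dot_ael mO) => //; exact: hd_Pi_L2.
- by apply: L2_integrableM => //; exact: hd_Pi_L2.
- by apply: L2mx_integrable_dot => //; [exact: L2mx_tapp|exact: hd_hess_L2].
Qed.

Lemma limit_defect_le xi h : L2mx Omega xi -> L2 Omega h ->
  (forall w, limit_defect B xi w =
    L2dot Omega h (hd_Pi w) - L2dotmx Omega (fun x => tapp B (xi x)) (hd_hess w)) ->
  forall w, `|limit_defect B xi w| <= W_D B D xi * energy w.
Proof.
move=> Lxi Lh dE; apply: limit_defect_le_of_linear => c v w.
rewrite !dE L2dot_Pi_linear// L2dotmx_hess_linear; last exact: L2mx_tapp.
by ring.
Qed.

End discretisation_theory.

(** * The duality estimate *)

(** In this section [HU] and [HG] stand for [B hess u] and [B hess phig], [Pu] and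
[Pg] for the interpolants of [u] and [phig], and [defu] and [defg] for the limit
defects of [hess u] and [hess phig], with bounds [Wu] and [Wg]. *)
Section error_estimate.
Context (R : realType) (d : nat) (Omega : set 'rV[R]_d).
Hypothesis mO : measurable Omega.
Variable D : hessian_discretisation Omega.
Variables (HU HG : 'rV[R]_d -> 'M[R]_d) (u f g : 'rV[R]_d -> R).
Variables (uD Pu Pg : D) (defu defg : D -> R) (Wu Wg : R).

Local Notation du := (L2normmx Omega (hd_hess Pu \- HU)).
Local Notation dg := (L2normmx Omega (hd_hess Pg \- HG)).

Hypotheses (LHU : L2mx Omega HU) (LHG : L2mx Omega HG).
Hypotheses (Lg : L2 Omega g) (Lu : L2 Omega u).
Hypothesis defuE : forall w : D,
  defu w = L2dot Omega f (hd_Pi w) - L2dotmx Omega HU (hd_hess w).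
Hypothesis defgE : forall w : D,
  defg w = L2dot Omega g (hd_Pi w) - L2dotmx Omega HG (hd_hess w).
Hypotheses (Wu0 : 0 <= Wu) (Wg0 : 0 <= Wg).
Hypothesis defu_le : forall w : D, `|defu w| <= Wu * energy w.
Hypothesis defg_le : forall w : D, `|defg w| <= Wg * energy w.
Hypothesis scheme : forall w : D, form_aD uD w = L2dot Omega f (hd_Pi w).
Hypothesis dual : L2dotmx Omega HU HG = L2dot Omega g u.

Let w0 : D := -1 *: uD + Pu.

(** Test the scheme with [w0] itself, and rewrite the right-hand side by means of
the defect [defu]. *)
Lemma energy_error_le : energy w0 <= du + Wu.
Proof.
have [->|e0] := eqVneq (energy w0) 0.
  by rewrite addr_ge0 ?L2normmx_ge0.
have ep : 0 < energy w0 by rewrite lt0r e0 energy_ge0.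
rewrite -(ler_pM2r ep) -expr2 sqr_energy.
have LPu := hd_hess_L2 Pu; have Lw := hd_hess_L2 w0.
have -> : form_aD w0 w0 = L2dotmx Omega (hd_hess Pu \- HU) (hd_hess w0) - defu w0.
  have E1 : form_aD w0 w0 = -1 * form_aD w0 uD + form_aD w0 Pu.
    by rewrite {2}/w0; exact: form_aD_linearr.
  have E2 : form_aD w0 uD = L2dot Omega f (hd_Pi w0) by rewrite form_aDC scheme.
  have E3 : form_aD w0 Pu = L2dotmx Omega (hd_hess Pu) (hd_hess w0).
    by rewrite form_aDC.
  by rewrite E1 E2 E3 defuE (L2dotmxBl mO LPu LHU Lw); ring.
have h1 := le_trans (ler_norm _) (cauchy_schwarz mO (L2mxB LPu LHU) Lw).
have h2 : - defu w0 <= Wu * energy w0.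
  by apply: le_trans (ler_norm _) _; rewrite normrN; exact: defu_le.
by rewrite mulrDl; apply: lerD.
Qed.

(** The defect [defg] turns the scalar products of [g] with reconstructions into
scalar products of Hessians, the scheme applied to [Pg] brings in [defu], and the
dual problem gives the term in [u]. What is left over factors as a product of
two interpolation errors. *)
Lemma dual_identity : L2dot Omega g (fun x => -1 * hd_Pi uD x + u x) =
  - defg Pu - defu Pg + defg w0
  - L2dotmx Omega (hd_hess Pg \- HG) (hd_hess w0)
  + L2dotmx Omega (hd_hess Pu \- HU) (hd_hess Pg \- HG).
Proof.
have LPu := hd_hess_L2 Pu; have Lw := hd_hess_L2 w0.
have LPg := hd_hess_L2 Pg; have LuD := hd_Pi_L2 uD.
rewrite (L2dot_linearr mO (-1) Lg LuD Lu) -dual !defgE defuE.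
have -> : L2dot Omega g (hd_Pi w0) =
    -1 * L2dot Omega g (hd_Pi uD) + L2dot Omega g (hd_Pi Pu).
  exact: L2dot_Pi_linear.
have -> : L2dot Omega f (hd_Pi Pg) = L2dotmx Omega (hd_hess Pg) (hd_hess uD).
  by rewrite -scheme form_aDC.
rewrite (L2dotmxBl mO LPg LHG Lw) (L2dotmxBl mO LPu LHU (L2mxB LPg LHG)).
rewrite (L2dotmxBr mO LPu LPg LHG) (L2dotmxBr mO LHU LPg LHG).
have -> : L2dotmx Omega (hd_hess Pg) (hd_hess w0) =
    -1 * L2dotmx Omega (hd_hess Pg) (hd_hess uD) +
    L2dotmx Omega (hd_hess Pg) (hd_hess Pu).
  exact: L2dotmx_hess_linear.
rewrite (L2dotmxC Omega (hd_hess Pu) HG) (L2dotmxC Omega (hd_hess Pu) (hd_hess Pg)).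
by ring.
Qed.

(** The two terms in [w0] add up to at most [(dg + Wg) * energy w0], and the last
one is at most [du * dg]; hence the constant 2. *)
Lemma dual_error_le :
  L2dot Omega g (fun x => -1 * hd_Pi uD x + u x) <=
  `|defg Pu| + `|defu Pg| + 2 * ((du + Wu) * (dg + Wg)).
Proof.
have LPu := hd_hess_L2 Pu; have Lw := hd_hess_L2 w0; have LPg := hd_hess_L2 Pg.
have du0 := L2normmx_ge0 Omega (hd_hess Pu \- HU).
have dg0 := L2normmx_ge0 Omega (hd_hess Pg \- HG).
have k1 : `|defg w0 - L2dotmx Omega (hd_hess Pg \- HG) (hd_hess w0)| <=
    (dg + Wg) * (du + Wu).
  apply: le_trans (ler_normB _ _) _.
  apply: (@le_trans _ _ ((dg + Wg) * energy w0)).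
    rewrite addrC mulrDl; apply: lerD; last exact: defg_le.
    exact: (cauchy_schwarz mO (L2mxB LPg LHG) Lw).
  by rewrite ler_wpM2l ?addr_ge0//; exact: energy_error_le.
have k2 : `|L2dotmx Omega (hd_hess Pu \- HU) (hd_hess Pg \- HG)| <=
    (du + Wu) * (dg + Wg).
  apply: le_trans (cauchy_schwarz mO (L2mxB LPu LHU) (L2mxB LPg LHG)) _.
  by apply: ler_pM => //; rewrite lerDl.
rewrite dual_identity; apply: le_trans (ler_norm _) _.
rewrite (mulrC (dg + Wg)) in k1.
apply: le_trans (ler_normD _ _) _; rewrite mulr2n mulrDl !mul1r addrA.
apply: lerD => //; rewrite -addrA.
apply: le_trans (ler_normD _ _) _; apply: lerD => //.
by apply: le_trans (ler_normB _ _) _; rewrite normrN.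
Qed.

End error_estimate.

Theorem theorem3p1 (R : realType) (d : nat) (Omega : set 'rV[R]_d) (M : R) :
  (0 < d)%N -> bounded_domain Omega ->
  exists C : R,
  forall (A : 'rV[R]_d -> tensor R d) (B : tensor R d) (rho : R),
  coefficient_tensor Omega A -> factorises Omega A B ->
  0 < rho -> coercive Omega B rho ->
  forall (f u : 'rV[R]_d -> R),
  L2 Omega f -> H20 Omega u ->
  (forall v, H20 Omega v ->
    form_a Omega B u v = integral_on Omega (fun x => f x * v x)) ->
  forall (D : hessian_discretisation Omega) (uD : D),
  C_D D <= M ->
  (forall vD : D,
    form_aD uD vD = integral_on Omega (fun x => f x * hd_Pi vD x)) ->
  ~ ae_on Omega (fun x => u x = hd_Pi uD x) ->
  forall (g phig : 'rV[R]_d -> R),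
  g = (fun x => (u x - hd_Pi uD x) / L2norm Omega (u \- hd_Pi uD)) ->
  H20 Omega phig ->
  (forall w, H20 Omega w ->
    form_a Omega B w phig = integral_on Omega (fun x => g x * w x)) ->
  forall P : ('rV[R]_d -> R) -> D,
  L2norm Omega (hd_Pi uD \- u) <=
  C * ((L2normmx Omega (hd_hess (P u) \- hessB Omega B u) + WS_D B D u)
       * (L2normmx Omega (hd_hess (P phig) \- hessB Omega B phig)
          + WS_D B D phig)
       + L2norm Omega (hd_Pi (P u) \- u)
       + L2norm Omega f * L2norm Omega (hd_Pi (P phig) \- phig)
       + `|limit_defect B (hess Omega u) (P phig)|
       + `|limit_defect B (hess Omega phig) (P u)|).
Proof.
move=> d0 [oO _ _ bO]; exists 2.
move=> A B rho _ _ _ _ f u Lf Hu uf D uD _ uDf _ g phig gE Hphig dualg P.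
have mO := open_measurable_rV oO.
have [H2u _] := Hu; have [H2g _] := Hphig.
have [[Lu _] _] := H2u.
have LuD := hd_Pi_L2 uD.
pose N := L2norm Omega (u \- hd_Pi uD).
have Lg : L2 Omega g.
  rewrite gE; have := L2Z N^-1 (L2B Lu LuD).
  by congr L2; apply/funext => x; rewrite mulrC.
have LHu := H2_hess_L2 H2u; have LHg := H2_hess_L2 H2g.
have gphi v : H20 Omega v ->
    form_a Omega B phig v = integral_on Omega (fun x => g x * v x).
  move=> Hv; rewrite -(dualg v Hv).
  exact: (L2dotmxC Omega (hessB Omega B phig) (hessB Omega B v)).
have [Lddu ddu] := divdiv_ae d0 oO bO (weak_solution_divdiv d0 oO bO Lf Hu uf).
have [Lddg ddg] := divdiv_ae d0 oO bO (weak_solution_divdiv d0 oO bO Lg Hphig gphi).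
have defuE := limit_defectE mO LHu Lf Lddu ddu.
have defgE := limit_defectE mO LHg Lg Lddg ddg.
have defu_le := limit_defect_le mO LHu Lf (@defuE D).
have defg_le := limit_defect_le mO LHg Lg (@defgE D).
have := dual_error_le mO (P u) (P phig) (L2mx_tapp B LHu) (L2mx_tapp B LHg) Lg Lu
  (@defuE D) (@defgE D) (W_D_ge0 B D _) (W_D_ge0 B D _) defu_le defg_le uDf
  (dualg _ Hu).
have -> : L2dot Omega g (fun x => -1 * hd_Pi uD x + u x) =
    L2norm Omega (hd_Pi uD \- u).
  have -> : L2norm Omega (hd_Pi uD \- u) = N.
    apply/eqP; rewrite -(@eqrXn2 _ 2) ?L2norm_ge0// !sqr_L2norm.
    by apply/eqP; congr integral_on; apply/funext => x /=; ring.
  rewrite /L2dot (_ : (fun _ => _) =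
    (fun x => N^-1 * ((u \- hd_Pi uD) x * (u \- hd_Pi uD) x))); last first.
    by apply/funext => x; rewrite gE /= -/N; ring.
  rewrite integral_onZ//; last first.
    by apply: L2_integrableM => //; exact: L2B.
  rewrite -sqr_L2norm -/N expr2.
  (* if the error vanishes then so does [g], since 0^-1 = 0 *)
  by have [->|N0] := eqVneq N 0; [rewrite !mulr0|rewrite mulKf].
move=> /le_trans; apply.
have collect (x y p q r s : R) : 0 <= x -> 0 <= y -> 0 <= r -> 0 <= s ->
    p <= q -> x + y + 2 * p <= 2 * (q + r + s + y + x) by lra.
apply: collect; [exact: normr_ge0|exact: normr_ge0|exact: L2norm_ge0|..].
  by apply: mulr_ge0; exact: L2norm_ge0.
apply: ler_pM.
- by apply: addr_ge0; [exact: L2normmx_ge0|exact: W_D_ge0].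
- by apply: addr_ge0; [exact: L2normmx_ge0|exact: W_D_ge0].
- by rewrite lerD2l; exact: WS_D_ge_W_D.
- by rewrite lerD2l; exact: WS_D_ge_W_D.
Qed.
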